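(* Let $f:\mathbb{R}^d\to\mathbb{R}$ be a tree ensemble model whose trees have $n$ nodes in total, and let $x\in\mathbb{R}^d$. Then for any $S\subseteq[d]$, the squared prediction gap $$\mathrm{PG}^2(x,S)=\mathbb{E}_{x'\sim \mathrm{perturb}(x,S)}\left[(f(x')-f(x))^2\right]$$ can be computed exactly in $O(n^2)$ time.
   Context: A decision tree $T$ is a rooted binary tree in which each non-leaf node $v$ has exactly two children $a_v,b_v$, a feature index $q_v\in[d]=\{1,\dots,d\}$ and a threshold $t_v\in\mathbb{R}$; each leaf $l$ has a value $y_l\in\mathbb{R}$. The output $f_T(x)$ on input $x\in\mathbb{R}^d$ is obtained by starting at the root and, at each non-leaf node $v$, descending to $a_v$ if $x_{q_v}<t_v$ and to $b_v$ otherwise, until a leaf $l$ is reached; then $f_T(x)=y_l$. A tree ensemble model is a finite collection of decision trees $T_1,\dots,T_m$ with output $f(x)=\sum_{i=1}^m f_{T_i}(x)$; its total size $n$ is the sum of the numbers of nodes of its trees. For $x\in\mathbb{R}^d$ and $S\subseteq[d]$, the distribution $\mathrm{perturb}(x,S)$ of a random vector $x'\in\mathbb{R}^d$ is as follows: for each $i\in S$, $x'_i=x_i+\delta_i$ where $\delta_i\sim\mathcal{D}_i$ for a fixed distribution $\mathcal{D}_i$ on $\mathbb{R}$; for each $i\notin S$, $x'_i=x_i$; and the $\delta_i$ ($i\in S$) are mutually independent. It is assumed that the cumulative distribution function $F_{\mathcal{D}_i}$ of each $\mathcal{D}_i$ can be evaluated in $O(1)$ time. The running time is measured in a model where arithmetic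 operations on real numbers take constant time.
   Formalization: The distribution function evaluated in O(1) is taken to be Pr[δ_i < t] rather than the usual Pr[δ_i ≤ t]; the two agree for atomless D_i, and with the usual one the exact claim fails when D_i may have atoms. *)

(* Defs.v *)
From HB Require Import structures.
From mathcomp Require Import all_boot all_order all_algebra.
From mathcomp Require Import all_classical all_reals all_analysis.
Set Implicit Arguments. Unset Strict Implicit. Unset Printing Implicit Defensive.
Import Order.TTheory GRing.Theory Num.Theory.
Local Open Scope ring_scope.
Local Open Scope classical_set_scope.

Inductive tree (d : nat) (R : Type) :=
| Leaf of R
| Node of 'I_d & R & tree d R & tree d R.

Arguments Leaf {d R}.
Arguments Node {d R}.

Section Trees.
Variables (R : realType) (d : nat).

Fixpoint tree_eval (T : tree d R) (x : 'I_d -> R) : R :=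
  match T with
  | Leaf y => y
  | Node q t a b => if x q < t then tree_eval a x else tree_eval b x
  end.

Fixpoint tree_size (T : tree d R) : nat :=
  match T with
  | Leaf _ => 1%N
  | Node _ _ a b => (tree_size a + tree_size b).+1
  end.

Definition ens_eval (E : seq (tree d R)) (x : 'I_d -> R) : R :=
  \sum_(T <- E) tree_eval T x.

Definition ens_size (E : seq (tree d R)) : nat :=
  \sum_(T <- E) tree_size T.

End Trees.

Section Perturb.
Variables (R : realType) (dm : measure_display) (Omega : measurableType dm)
          (P : probability Omega R) (d : nat).

(* the delta_i (i in S) are mutually independent: product rule for every
   family of measurable sets (taking B_i = setT gives every subfamily) *)
Definition mutually_independent (S : {set 'I_d}) (delta : 'I_d -> Omega -> R) :=
  forall B : 'I_d -> set R, (forall i, measurable (B i)) ->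
    P (\big[setI/setT]_(i in S) (delta i @^-1` B i))
    = (\prod_(i in S) P (delta i @^-1` B i))%E.

Definition perturbed (x : 'I_d -> R) (S : {set 'I_d})
  (delta : 'I_d -> Omega -> R) (w : Omega) : 'I_d -> R :=
  fun i => if i \in S then x i + delta i w else x i.

Definition PG2 (E : seq (tree d R)) (x : 'I_d -> R) (S : {set 'I_d})
  (delta : 'I_d -> Omega -> R) : \bar R :=
  (\int[P]_w ((ens_eval E (perturbed x S delta w) - ens_eval E x) ^+ 2)%:E)%E.

(* the (left-continuous) distribution function of D_i:
   F_i(t) = Pr[delta_i < t] *)
Definition cdf_of (delta : Omega -> R) (t : R) : R :=
  fine (P [set w | delta w < t]).

End Perturb.

Inductive instr :=
| IConst of nat & nat
| IAdd of nat & nat & nat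
| ISub of nat & nat & nat      (* ISub a b c   : im a := im b - im c (trunc.) *)
| ILoad of nat & nat
| IStore of nat & nat
| RConst of nat & rat
| RAdd of nat & nat & nat
| RSub of nat & nat & nat
| RMul of nat & nat & nat
| RDiv of nat & nat & nat
| RLoad of nat & nat
| RStore of nat & nat
| ROracle of nat & nat & nat
| JLtR of nat & nat & nat
| JLtI of nat & nat & nat
| Jmp of nat
| Halt.

Record state (R : Type) := State { pc : nat; im : nat -> nat; rm : nat -> R }.
Arguments State {R}.

Section RAM.
Variables (R : realType) (prog : seq instr) (oracle : nat -> R -> R).

Definition upd {T : Type} (f : nat -> T) (a : nat) (v : T) : nat -> T :=
  fun b => if b == a then v else f b.

Definition halted (s : state R) : bool :=
  if nth Halt prog (pc s) is Halt then true else false.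

Definition step (s : state R) : state R :=
  let: State p Im M := s in
  let nx := p.+1 in
  match nth Halt prog p with
  | IConst a k => State nx (upd Im a k) M
  | IAdd a b c => State nx (upd Im a (Im b + Im c)%N) M
  | ISub a b c => State nx (upd Im a (Im b - Im c)%N) M
  | ILoad a q => State nx (upd Im a (Im (Im q))) M
  | IStore q a => State nx (upd Im (Im q) (Im a)) M
  | RConst a r => State nx Im (upd M a (ratr r))
  | RAdd a b c => State nx Im (upd M a (M b + M c))
  | RSub a b c => State nx Im (upd M a (M b - M c))
  | RMul a b c => State nx Im (upd M a (M b * M c))
  | RDiv a b c => State nx Im (upd M a (M b / M c))
  | RLoad a q => State nx Im (upd M a (M (Im q)))
  | RStore q a => State nx Im (upd M (Im q) (M a))
  | ROracle a q b => State nx Im (upd M a (oracle (Im q) (M b)))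
  | JLtR a b l => State (if M a < M b then l else nx) Im M
  | JLtI a b l => State (if (Im a < Im b)%N then l else nx) Im M
  | Jmp l => State l Im M
  | Halt => s
  end.

Fixpoint exec (k : nat) (s : state R) : state R :=
  if k is k'.+1 then exec k' (step s) else s.

End RAM.

(* Nodes of all trees are numbered 0..n-1 in preorder, tree by tree.   *)

Record enode (R : Type) := ENode
  { en_leaf : bool; en_feat : nat; en_val : R; en_left : nat; en_right : nat }.
Arguments ENode {R}.

Section Encode.
Variables (R : realType) (d : nat).

Fixpoint enc_tree (base : nat) (T : tree d R) : seq (enode R) :=
  match T with
  | Leaf y => [:: ENode true 0%N y 0%N 0%N]
  | Node q t a b =>
      ENode false (nat_of_ord q) t base.+1 (base.+1 + tree_size a)%N
        :: enc_tree base.+1 a ++ enc_tree (base.+1 + tree_size a)%N b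
  end.

Fixpoint enc_ens (base : nat) (E : seq (tree d R)) : seq (enode R) * seq nat :=
  match E with
  | [::] => ([::], [::])
  | T :: E' =>
      let: (ns, rs) := enc_ens (base + tree_size T)%N E' in
      (enc_tree base T ++ ns, base :: rs)
  end.

Definition dflt_node : enode R := ENode false 0%N 0 0%N 0%N.

(* Integer memory:
     im 0 = m (number of trees), im 1 = n (total nodes), im 2 = d,
     im 3..7 = 0,
     for j : im (8 + 8j + 0) = 1 if node j is a leaf, else 0
             im (8 + 8j + 1) = feature q_j of node j
             im (8 + 8j + 2) = number of left child a_j
             im (8 + 8j + 3) = number of right child b_j
             im (8 + 8j + 4) = number of the root of tree j   (j < m)
             im (8 + 8j + 5) = 1 if j < d and j \in S, else 0
             im (8 + 8j + 6), im (8 + 8j + 7) = 0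
   Real memory:
             rm (8j + 0) = threshold t_j of node j (or leaf value y_j)
             rm (8j + 1) = x_j                                  (j < d)
             everything else 0. *)
Definition init_im (E : seq (tree d R)) (S : {set 'I_d}) : nat -> nat :=
  let ns := (enc_ens 0 E).1 in
  let rs := (enc_ens 0 E).2 in
  fun a =>
    if (a < 8)%N then
      (if a == 0%N then size E else if a == 1%N then ens_size E
       else if a == 2%N then d else 0)%N
    else
      let j := ((a - 8) %/ 8)%N in
      let c := ((a - 8) %% 8)%N in
      let nd := nth dflt_node ns j in
      (if c == 0%N then (if (j < size ns)%N then nat_of_bool (en_leaf nd) else 0)
       else if c == 1%N then en_feat nd
       else if c == 2%N then en_left nd
       else if c == 3%N then en_right nd
       else if c == 4%N then nth 0 rs j
       else if c == 5%N then
         (if insub j is Some i then nat_of_bool (i \in S) else 0)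
       else 0)%N.

Definition init_rm (E : seq (tree d R)) (x : 'I_d -> R) : nat -> R :=
  let ns := (enc_ens 0 E).1 in
  fun a =>
    let j := (a %/ 8)%N in
    let c := (a %% 8)%N in
    if c == 0%N then en_val (nth dflt_node ns j)
    else if c == 1%N then (if insub j is Some i then x i else 0)
    else 0.

Definition init_state (E : seq (tree d R)) (x : 'I_d -> R) (S : {set 'I_d})
  : state R := State 0%N (init_im E S) (init_rm E x).

Definition feature_oracle (dm : measure_display) (Omega : measurableType dm)
  (P : probability Omega R) (delta : 'I_d -> Omega -> R) : nat -> R -> R :=
  fun i t => if insub i is Some i' then cdf_of P (delta i') t else 0.

End Encode.

(* Main.v *)
Require Import Defs.
From HB Require Import structures.
From mathcomp Require Import all_boot all_order all_algebra.
From mathcomp Require Import all_classical all_reals all_analysis.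
From mathcomp Require Import measurable_realfun zify ring lra.
Set Implicit Arguments. Unset Strict Implicit. Unset Printing Implicit Defensive.
Import Order.TTheory GRing.Theory Num.Theory.
Local Open Scope classical_set_scope.
Local Open Scope ring_scope.

(* The coordinates of x' are independent (a coordinate outside S is a point mass), so the
   probability that x' satisfies all tests on a path, or on two paths jointly, is a product
   over the features i of the mass of an interval of the form [lo, hi). Only the values
   of the distribution function at the end points matter, and these are maxima over the
   tests of the path. Adding one test multiplies the product by the quotient of two interval
   masses; with 0^-1 = 0 this remains correct when the mass is 0.

   With C = f(x), expanding the square gives
     PG^2 = sum_u y_u P(u) (sum_v y_v P(v | u) - 2 C) + C^2,
   where u and v range over the leaves. A first pass over the nodes in preorder pushes the
   interval of every node of the ensemble's feature, P(u) and [x reaches u] from each node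
   to its children, in time O(n) per node. A second pass computes, for each leaf u, all
   the numbers P(v | u) in O(n) time, the interval of the joint path being the intersection
   of two tabulated ones.

   The program is verified in a language of loops of length n, whose functional semantics
   the compilation to machine code preserves. *)

(** * A structured language on the machine *)

Inductive rop := OAdd | OSub | OMul | ODiv.

(** Control flow is limited to conditionals and loops of exactly [N] rounds, so the running time can
    be bounded from the syntax alone. Only real arrays are written at computed indices. *)
Inductive cmd :=
| CSet of nat & nat
| CAdd of nat & nat & nat
| CAddN of nat & nat
| CField of nat & nat & nat
| CConst of nat & rat
| COp of rop & nat & nat & nat
| CGet of nat & nat & nat
| CPut of nat & nat & nat
| CCdf of nat & nat & nat
| CMax of nat & nat
| CSkip
| CSeq of cmd & cmd
| CIfR of nat & nat & cmd & cmd
| CIfI of nat & nat & cmd & cmd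
| CFor of nat & cmd.

Record store (R : Type) :=
  Store { ireg : nat -> nat; rreg : nat -> R; arr : nat -> nat -> R }.
Arguments Store {R}.

Definition rop_fun (R : realType) (o : rop) (x y : R) : R :=
  match o with OAdd => x + y | OSub => x - y | OMul => x * y | ODiv => x / y end.

(* Convertible to [upd], but reduces on numerals without unfolding [==]. *)
Definition updn {T : Type} (f : nat -> T) (a : nat) (v : T) : nat -> T :=
  fun b => if eqn b a then v else f b.

Lemma updnE (T : Type) (f : nat -> T) a v : updn f a v = upd f a v.
Proof. by []. Qed.

Section Language.
Variables (R : realType) (oracle : nat -> R -> R) (N : nat) (inp : nat -> nat -> nat).

Definition set_ireg (h : store R) a v := Store (updn (ireg h) a v) (rreg h) (arr h).
Definition set_rreg (h : store R) a v := Store (ireg h) (updn (rreg h) a v) (arr h).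
Definition set_arr (h : store R) c a v :=
  Store (ireg h) (rreg h) (updn (arr h) c (updn (arr h c) a v)).

Fixpoint den (s : cmd) (h : store R) : store R :=
  match s with
  | CSet a k => set_ireg h a k
  | CAdd a b c => set_ireg h a (ireg h b + ireg h c)%N
  | CAddN a b => set_ireg h a (ireg h b + N)%N
  | CField a c i => set_ireg h a (inp c (ireg h i))
  | CConst a r => set_rreg h a (ratr r)
  | COp o a b c => set_rreg h a (rop_fun o (rreg h b) (rreg h c))
  | CGet a c i => set_rreg h a (arr h c (ireg h i))
  | CPut c i a => set_arr h c (ireg h i) (rreg h a)
  | CCdf a q b => set_rreg h a (oracle (ireg h q) (rreg h b))
  | CMax a b => set_rreg h a (Num.max (rreg h a) (rreg h b))
  | CSkip => h
  | CSeq s1 s2 => den s2 (den s1 h)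
  | CIfR a b s1 s2 => if rreg h a < rreg h b then den s1 h else den s2 h
  | CIfI a b s1 s2 => if (ireg h a < ireg h b)%N then den s1 h else den s2 h
  | CFor i s1 =>
      iter N (fun h' => let h1 := den s1 h' in set_ireg h1 i (ireg h1 i).+1)
           (set_ireg h i 0%N)
  end.

Fixpoint iregs (s : cmd) : seq nat :=
  match s with
  | CSet a _ | CAdd a _ _ | CAddN a _ | CField a _ _ => [:: a]
  | CSeq s1 s2 | CIfR _ _ s1 s2 | CIfI _ _ s1 s2 => iregs s1 ++ iregs s2
  | CFor i s1 => i :: iregs s1
  | _ => [::]
  end.

Fixpoint rregs (s : cmd) : seq nat :=
  match s with
  | CConst a _ | COp _ a _ _ | CGet a _ _ | CCdf a _ _ | CMax a _ => [:: a]
  | CSeq s1 s2 | CIfR _ _ s1 s2 | CIfI _ _ s1 s2 => rregs s1 ++ rregs s2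
  | CFor _ s1 => rregs s1
  | _ => [::]
  end.

Fixpoint chans (s : cmd) : seq nat :=
  match s with
  | CPut c _ _ => [:: c]
  | CSeq s1 s2 | CIfR _ _ s1 s2 | CIfI _ _ s1 s2 => chans s1 ++ chans s2
  | CFor _ s1 => chans s1
  | _ => [::]
  end.

Fixpoint wf_cmd (s : cmd) : bool :=
  match s with
  | CField _ c _ => (c < 6)%N
  | CGet _ c _ | CPut c _ _ => (c < 7)%N
  | CSeq s1 s2 | CIfR _ _ s1 s2 | CIfI _ _ s1 s2 => wf_cmd s1 && wf_cmd s2
  | CFor i s1 => (i \notin iregs s1) && wf_cmd s1
  | _ => true
  end.

(** In both memories the addresses congruent to 7 modulo 8 initially hold 0 and carry no input, so
    registers placed there start at 0 and never meet an array. *)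
Definition reg (k : nat) : nat := (8 * k + 7)%N.

(* Integer cells 6 and 14 are scratch: neither inputs nor of the form [reg k]. *)
Definition address (i c : nat) : seq instr :=
  [:: IAdd 6 (reg i) (reg i); IAdd 6 6 6; IAdd 6 6 6; IConst 14 c; IAdd 6 6 14].

Definition rinstr (o : rop) : nat -> nat -> nat -> instr :=
  match o with OAdd => RAdd | OSub => RSub | OMul => RMul | ODiv => RDiv end.

Fixpoint csize (s : cmd) : nat :=
  match s with
  | CField _ _ _ | CGet _ _ _ | CPut _ _ _ => 6
  | CMax _ _ => 4
  | CSkip => 0
  | CSeq s1 s2 => csize s1 + csize s2
  | CIfR _ _ s1 s2 | CIfI _ _ s1 s2 => (csize s2 + csize s1).+2
  | CFor _ s1 => (csize s1 + 6)%N
  | _ => 1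
  end.

(** [p] is the address of the first instruction, since jump targets are absolute. In a conditional
    the else branch comes first and is entered by falling through. There is no move instruction;
    [CMax] copies by clearing the target and adding. *)
Fixpoint compile (p : nat) (s : cmd) : seq instr :=
  match s with
  | CSet a k => [:: IConst (reg a) k]
  | CAdd a b c => [:: IAdd (reg a) (reg b) (reg c)]
  | CAddN a b => [:: IAdd (reg a) (reg b) 1]
  | CField a c i => address i (8 + c) ++ [:: ILoad (reg a) 6]
  | CConst a r => [:: RConst (reg a) r]
  | COp o a b c => [:: rinstr o (reg a) (reg b) (reg c)]
  | CGet a c i => address i c ++ [:: RLoad (reg a) 6]
  | CPut c i a => address i c ++ [:: RStore 6 (reg a)]
  | CCdf a q b => [:: ROracle (reg a) (reg q) (reg b)]
  | CMax a b => [:: JLtR (reg a) (reg b) p.+2; Jmp (p + 4);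
                    RSub (reg a) (reg a) (reg a); RAdd (reg a) (reg a) (reg b)]
  | CSkip => [::]
  | CSeq s1 s2 => compile p s1 ++ compile (p + csize s1) s2
  | CIfR a b s1 s2 =>
      let l := (p.+2 + csize s2)%N in
      JLtR (reg a) (reg b) l :: compile p.+1 s2 ++ Jmp (l + csize s1) :: compile l s1
  | CIfI a b s1 s2 =>
      let l := (p.+2 + csize s2)%N in
      JLtI (reg a) (reg b) l :: compile p.+1 s2 ++ Jmp (l + csize s1) :: compile l s1
  | CFor i s1 =>
      [:: IConst (reg i) 0; JLtI (reg i) 1 p.+3; Jmp (p + csize s1 + 6)] ++
      compile p.+3 s1 ++
      [:: IConst 6 1; IAdd (reg i) (reg i) 6; Jmp p.+1]
  end.

Lemma size_compile p s : size (compile p s) = csize s.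
Proof.
elim: s p => //= [s1 H1 s2 H2 p|a b s1 H1 s2 H2 p|a b s1 H1 s2 H2 p|i s1 H1 p].
- by rewrite size_cat H1 H2.
- by rewrite size_cat /= H1 H2 addnS.
- by rewrite size_cat /= H1 H2 addnS.
- by rewrite size_cat /= H1; lia.
Qed.

(** Charging a conditional for both branches makes the bound independent of the data. A round of a
    loop costs its body, the test and three closing instructions; the summand 3 is the
    initialisation and the last test with its exit jump. *)
Fixpoint cost (s : cmd) : nat :=
  match s with
  | CField _ _ _ | CGet _ _ _ | CPut _ _ _ => 6
  | CMax _ _ => 4
  | CSkip => 0
  | CSeq s1 s2 => cost s1 + cost s2
  | CIfR _ _ s1 s2 | CIfI _ _ s1 s2 => (cost s1 + cost s2).+2
  | CFor _ s1 => (N * (cost s1 + 4) + 3)%N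
  | _ => 1
  end.

(** The scratch cells 6 and 14 are left unconstrained, so address computations preserve the
    relation. *)
Definition represents (h : store R) (Im : nat -> nat) (M : nat -> R) : Prop :=
  [/\ Im 1%N = N, forall k, Im (reg k) = ireg h k,
      forall k c, (c < 6)%N -> Im (8 * k + (8 + c))%N = inp c k,
      forall k, M (reg k) = rreg h k
    & forall k c, (c < 7)%N -> M (8 * k + c)%N = arr h c k].

(** * Correctness and running time of the compiled code *)

Section Simulation.
Variable prog : seq instr.

Definition code_at (p : nat) (l : seq instr) : Prop :=
  forall i, (i < size l)%N -> nth Halt prog (p + i) = nth Halt l i.

Lemma code_at_cat p l1 l2 :
  code_at p (l1 ++ l2) -> code_at p l1 /\ code_at (p + size l1) l2.
Proof.
move=> H; split=> i Hi.
  by rewrite H ?size_cat ?nth_cat ?Hi //; lia.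
rewrite -addnA H ?size_cat ?nth_cat; last by lia.
by rewrite ltnNge leq_addr /= addKn.
Qed.

Lemma code_at_cons p i l :
  code_at p (i :: l) -> nth Halt prog p = i /\ code_at p.+1 l.
Proof.
move=> H; split; first by have := H 0%N isT; rewrite addn0.
by move=> j Hj; rewrite addSnnS (H j.+1).
Qed.

Lemma exec_add k1 k2 (s : state R) :
  exec prog oracle (k1 + k2) s = exec prog oracle k2 (exec prog oracle k1 s).
Proof. by elim: k1 s => //= k1 IH s; rewrite IH. Qed.

Lemma exec1 (s : state R) : exec prog oracle 1 s = step prog oracle s.
Proof. by []. Qed.

Definition straight (i : instr) : bool :=
  match i with JLtR _ _ _ | JLtI _ _ _ | Jmp _ | Halt => false | _ => true end.

Definition effect (m : (nat -> nat) * (nat -> R)) (i : instr) :=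
  let s := step [:: i] oracle (State 0 m.1 m.2) in (im s, rm s).

Lemma exec_straight l p Im M : all straight l -> code_at p l ->
  exec prog oracle (size l) (State p Im M) =
  let m := foldl effect (Im, M) l in State (p + size l) m.1 m.2.
Proof.
elim: l p Im M => [|i l IH] p Im M; first by rewrite addn0.
case/andP=> si sl /code_at_cons [Hi Hl].
rewrite -[exec _ _ _ _]/(exec prog oracle (size l) (step prog oracle _)).
have -> : step prog oracle (State p Im M) =
  State p.+1 (effect (Im, M) i).1 (effect (Im, M) i).2.
  by rewrite /effect /= Hi; case: i si {Hi}.
by rewrite IH // addSnnS -surjective_pairing.
Qed.

Lemma represents_set_ireg h Im Im' M a v : represents h Im M ->
  Im' (reg a) = v ->
  (forall b, b != reg a -> b != 6%N -> b != 14%N -> Im' b = Im b) ->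
  represents (set_ireg h a v) Im' M.
Proof.
case=> HN Hr Hi Hf Ha Ev Eo; split=> //=.
- by rewrite Eo // /reg; lia.
- move=> k; rewrite ?updnE /upd; case: eqP => [-> //|Hk].
  by rewrite Eo // /reg; lia.
- by move=> k c Hc; rewrite Eo ?Hi // /reg; lia.
Qed.

Lemma represents_scratch h Im Im' M : represents h Im M ->
  (forall b, b != 6%N -> b != 14%N -> Im' b = Im b) ->
  represents h Im' M.
Proof.
case=> HN Hr Hi Hf Ha Eo; split=> //=.
- by rewrite Eo.
- by move=> k; rewrite Eo // /reg; lia.
- by move=> k c Hc; rewrite Eo ?Hi //; lia.
Qed.

Lemma represents_set_rreg h Im M a v : represents h Im M ->
  represents (set_rreg h a v) Im (upd M (reg a) v).
Proof.
case=> HN Hr Hi Hf Ha; split=> //=.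
- move=> k; rewrite ?updnE /upd; case: (k =P a) => [->|Hk]; first by rewrite eqxx.
  by rewrite ifF ?Hf // /reg; lia.
- by move=> k c Hc; rewrite /upd ifF ?Ha // /reg; lia.
Qed.

Lemma represents_set_arr h Im M c a v : (c < 7)%N -> represents h Im M ->
  represents (set_arr h c a v) Im (upd M (8 * a + c)%N v).
Proof.
move=> Hc [HN Hr Hi Hf Ha]; split=> //=.
- by move=> k; rewrite /upd ifF ?Hf // /reg; lia.
- move=> k c' Hc'; rewrite !updnE /upd; case: (c' =P c) => [->|Hcc].
    case: (k =P a) => [->|Hk]; first by rewrite eqxx.
    by rewrite ifF ?Ha //; lia.
  by rewrite ifF ?Ha //; lia.
Qed.

(** Three doublings multiply the index by 8 before the column is added. *)
Lemma foldl_address i c Im M :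
  let m := foldl effect (Im, M) (address i c) in
  [/\ m.2 = M, m.1 6%N = (8 * Im (reg i) + c)%N
    & forall b, b != 6%N -> b != 14%N -> m.1 b = Im b].
Proof.
split=> //=; first by rewrite /upd /=; lia.
by move=> b H6 H14; rewrite /upd (negbTE H6) (negbTE H14).
Qed.

(** Frame rule: with its analogues for real registers and arrays, it carries values across a block
    by a membership test that computation decides. *)
Lemma den_ireg i s h : i \notin iregs s -> ireg (den s h) i = ireg h i.
Proof.
elim: s h => //=.
- by move=> a k h H; rewrite updnE /upd ifN // -mem_seq1.
- by move=> a k l h H; rewrite updnE /upd ifN // -mem_seq1.
- by move=> a k h H; rewrite updnE /upd ifN // -mem_seq1.
- by move=> a k l h H; rewrite updnE /upd ifN // -mem_seq1.
- by move=> s1 H1 s2 H2 h; rewrite mem_cat negb_or => /andP[? ?]; rewrite H2 ?H1.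
- by move=> a b s1 H1 s2 H2 h; rewrite mem_cat negb_or => /andP[? ?]; case: ifP => _; rewrite ?H2 ?H1.
- by move=> a b s1 H1 s2 H2 h; rewrite mem_cat negb_or => /andP[? ?]; case: ifP => _; rewrite ?H2 ?H1.
- move=> j s1 H1 h; rewrite in_cons negb_or => /andP[Hj Hs].
  elim: N => /= [|k IH]; rewrite updnE /upd (negbTE Hj) //.
  by rewrite H1.
Qed.

Lemma den_rreg r s h : r \notin rregs s -> rreg (den s h) r = rreg h r.
Proof.
elim: s h => //=.
- by move=> a k h H; rewrite updnE /upd ifN // -mem_seq1.
- by move=> o a k l h H; rewrite updnE /upd ifN // -mem_seq1.
- by move=> a k l h H; rewrite updnE /upd ifN // -mem_seq1.
- by move=> a k l h H; rewrite updnE /upd ifN // -mem_seq1.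
- by move=> a k h H; rewrite updnE /upd ifN // -mem_seq1.
- by move=> s1 H1 s2 H2 h; rewrite mem_cat negb_or => /andP[? ?]; rewrite H2 ?H1.
- by move=> a b s1 H1 s2 H2 h; rewrite mem_cat negb_or => /andP[? ?]; case: ifP => _; rewrite ?H2 ?H1.
- by move=> a b s1 H1 s2 H2 h; rewrite mem_cat negb_or => /andP[? ?]; case: ifP => _; rewrite ?H2 ?H1.
- by move=> j s1 H1 h Hr; elim: N => //= k IH; rewrite H1.
Qed.

Lemma den_arr c s h : c \notin chans s -> arr (den s h) c = arr h c.
Proof.
elim: s h => //=.
- by move=> a k l h H; rewrite updnE /upd ifN // -mem_seq1.
- by move=> s1 H1 s2 H2 h; rewrite mem_cat negb_or => /andP[? ?]; rewrite H2 ?H1.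
- by move=> a b s1 H1 s2 H2 h; rewrite mem_cat negb_or => /andP[? ?]; case: ifP => _; rewrite ?H2 ?H1.
- by move=> a b s1 H1 s2 H2 h; rewrite mem_cat negb_or => /andP[? ?]; case: ifP => _; rewrite ?H2 ?H1.
- by move=> j s1 H1 h Hr; elim: N => //= k IH; rewrite H1.
Qed.

Definition simulates (p : nat) (s : cmd) : Prop :=
  forall h Im M, represents h Im M ->
  exists k Im' M', [/\ (k <= cost s)%N,
    exec prog oracle k (State p Im M) = State (p + csize s) Im' M'
    & represents (den s h) Im' M'].

Lemma simulates_straight p s :
  all straight (compile p s) -> (csize s <= cost s)%N ->
  code_at p (compile p s) ->
  (forall h Im M, represents h Im M ->
     let m := foldl effect (Im, M) (compile p s) in
     represents (den s h) m.1 m.2) ->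
  simulates p s.
Proof.
move=> Hs Hc Hp H h Im M Hr.
exists (csize s); do 2 eexists; split=> //; last exact: H Hr.
by rewrite -(size_compile p) exec_straight.
Qed.

(** One argument for both kinds of conditional: the test enters only as a boolean [b] of the
    memory. *)
Lemma simulates_if p c1 c2 b s1 s2 (l := (p.+2 + csize s2)%N) :
  (forall Im M, step prog oracle (State p Im M) =
                State (if b Im M then l else p.+1) Im M) ->
  nth Halt prog (p.+1 + csize s2) = Jmp (l + csize s1) ->
  c1 = cost s1 -> c2 = cost s2 ->
  simulates p.+1 s2 -> simulates l s1 ->
  forall h Im M, represents h Im M ->
  exists k Im' M', [/\ (k <= (c1 + c2).+2)%N,
    exec prog oracle k (State p Im M) = State (l + csize s1) Im' M'
    & represents (if b Im M then den s1 h else den s2 h) Im' M'].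
Proof.
move=> Hstep Hj -> -> H2 H1 h Im M Hr.
case Hb: (b Im M).
  have [k [Im' [M' [Hk He Hr']]]] := H1 h Im M Hr.
  exists k.+1, Im', M'; split=> //; first by lia.
  by rewrite -(add1n k) exec_add exec1 Hstep Hb.
have [k [Im' [M' [Hk He Hr']]]] := H2 h Im M Hr.
exists (1 + (k + 1))%N, Im', M'; split=> //; first by lia.
by rewrite exec_add exec1 Hstep Hb exec_add He exec1 /step Hj.
Qed.

Lemma simulates_for p i s : i \notin iregs s ->
  code_at p (compile p (CFor i s)) ->
  simulates p.+3 s -> simulates p (CFor i s).
Proof.
move=> Hw Hcode Hs h Im M Hr.
move: Hcode => /= /code_at_cons[C0 /code_at_cons[C1 /code_at_cons[C2 /code_at_cat[_]]]].
rewrite size_compile => /code_at_cons[D0 /code_at_cons[D1 /code_at_cons[D2 _]]].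
pose body (h' : store R) := let h1 := den s h' in set_ireg h1 i (ireg h1 i).+1.
pose loop n := iter n body (set_ireg h i 0%N).
have Hloopi n : ireg (loop n) i = n.
  by elim: n => /= [|n IH]; rewrite updnE /upd eqxx // den_ireg // IH.
(* Invariant: after n rounds the machine is back at the loop test, at address [p.+1]. The index then
   equals n because the body never assigns it. *)
suff H n : (n <= N)%N -> exists k Im' M', [/\ (k <= n * (cost s + 4) + 1)%N,
    exec prog oracle k (State p Im M) = State p.+1 Im' M'
    & represents (loop n) Im' M'].
  have [k [Im' [M' [Hk He Hr']]]] := H N (leqnn N).
  exists (k + 2)%N, Im', M'; split=> //=; first by lia.
  rewrite exec_add He /= /step C1.
  have [HN Hreg _ _ _] := Hr'.
  by rewrite HN Hreg Hloopi ltnn C2; congr State; lia.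
elim: n => [|n IH] Hn.
  exists 1%N, (upd Im (reg i) 0%N), M; split=> //=; first by rewrite C0.
  apply: represents_set_ireg Hr _ _; first by rewrite /upd eqxx.
  by move=> b Hb _ _; rewrite /upd (negbTE Hb).
have [k [Im1 [M1 [Hk He Hr1]]]] := IH (ltnW Hn).
have [k2 [Im2 [M2 [Hk2 He2 Hr2]]]] := Hs _ _ _ Hr1.
exists (k + (1 + (k2 + 3)))%N, (upd (upd Im2 6 1) (reg i) (Im2 (reg i)).+1)%N, M2.
split; first by lia.
  rewrite exec_add He exec_add /= /step C1.
  have [HN Hreg _ _ _] := Hr1.
  rewrite HN Hreg Hloopi Hn exec_add He2 /= /step D0 D1 D2.
  have -> : upd Im2 6%N 1%N (reg i) = Im2 (reg i) by rewrite /upd ifF // /reg; lia.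
  by rewrite addn1.
have [_ Hreg _ _ _] := Hr2.
rewrite Hreg; apply: represents_set_ireg Hr2 _ _; first by rewrite /upd eqxx.
by move=> b Hb H6 _; rewrite /upd (negbTE Hb) (negbTE H6).
Qed.

Theorem compile_correct p s :
  wf_cmd s -> code_at p (compile p s) -> simulates p s.
Proof.
elim: s p.
- move=> a k p _ Hc; apply: simulates_straight => // h Im M Hr /=.
  apply: represents_set_ireg Hr _ _; first by rewrite /upd eqxx.
  by move=> b Hb _ _; rewrite /upd (negbTE Hb).
- move=> a b c p _ Hc; apply: simulates_straight => // h Im M Hr /=.
  have [_ Hreg _ _ _] := Hr; rewrite !Hreg.
  apply: represents_set_ireg Hr _ _; first by rewrite /upd eqxx.
  by move=> d Hb _ _; rewrite /upd (negbTE Hb).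
- move=> a b p _ Hc; apply: simulates_straight => // h Im M Hr /=.
  have [HN Hreg _ _ _] := Hr; rewrite !Hreg HN.
  apply: represents_set_ireg Hr _ _; first by rewrite /upd eqxx.
  by move=> d Hb _ _; rewrite /upd (negbTE Hb).
- move=> a c i p /= Hc6 Hc; apply: simulates_straight => // h Im M Hr.
  rewrite (_ : compile _ _ = address i (8 + c) ++ [:: ILoad (reg a) 6]) // foldl_cat.
  case: (foldl_address i (8 + c) Im M).
  move: (foldl _ _ _) => [Im1 M1] /= -> H6 Ho.
  have [_ Hreg Hinp _ _] := Hr.
  have -> : Im1 (Im1 6) = inp c (ireg h i).
    by rewrite H6 Ho ?Hreg ?Hinp //; lia.
  apply: represents_set_ireg Hr _ _; first by rewrite /upd eqxx.
  by move=> d Hb ? ?; rewrite /upd (negbTE Hb) Ho.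
- move=> a r p _ Hc; apply: simulates_straight => // h Im M Hr /=.
  exact: represents_set_rreg.
- move=> o a b c p _ Hc; apply: simulates_straight => //; first by case: o {Hc}.
  move=> h Im M Hr; have [_ _ _ Hreg _] := Hr.
  case: o {Hc} => /=; rewrite !Hreg; exact: represents_set_rreg.
- move=> a c i p /= Hc7 Hc; apply: simulates_straight => // h Im M Hr.
  rewrite (_ : compile _ _ = address i c ++ [:: RLoad (reg a) 6]) // foldl_cat.
  case: (foldl_address i c Im M).
  move: (foldl _ _ _) => [Im1 M1] /= -> H6 Ho.
  have [_ Hreg _ _ Harr] := Hr.
  rewrite H6 Hreg Harr //; apply: represents_set_rreg.
  exact: represents_scratch Hr Ho.
- move=> c i a p /= Hc7 Hc; apply: simulates_straight => // h Im M Hr.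
  rewrite (_ : compile _ _ = address i c ++ [:: RStore 6 (reg a)]) // foldl_cat.
  case: (foldl_address i c Im M).
  move: (foldl _ _ _) => [Im1 M1] /= -> H6 Ho.
  have [_ Hreg _ Hf _] := Hr.
  rewrite H6 Hreg Hf; apply: represents_set_arr => //.
  exact: represents_scratch Hr Ho.
- move=> a q b p _ Hc; apply: simulates_straight => // h Im M Hr /=.
  have [_ Hreg _ Hf _] := Hr; rewrite Hreg Hf.
  exact: represents_set_rreg.
- move=> a b p _ /code_at_cons[C0 /code_at_cons[C1 /code_at_cons[C2 /code_at_cons[C3 _]]]].
  move=> h Im M Hr; have [_ _ _ Hf _] := Hr.
  have [Hab|Hab] := ltP (rreg h a) (rreg h b).
    exists 3%N; do 2 eexists; split=> //=.
      by rewrite C0 !Hf Hab /step C2 C3 addn4.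
    have -> : Num.max (rreg h a) (rreg h b) = M (reg a) - M (reg a) + rreg h b.
      by rewrite subrr add0r (max_idPr (ltW Hab)).
    have := represents_set_rreg a (M (reg a) - M (reg a) + rreg h b) Hr.
    congr represents; apply/funext => k; rewrite /upd eqxx.
    case: eqP => // _; case: eqP => [e|_]; last by rewrite (Hf b).
    (* Clearing [a] would destroy [b] if the registers coincided, but then the strict comparison
       could not have succeeded. *)
    have ab : a = b by move: e; rewrite /reg; lia.
    by rewrite ab ltxx in Hab.
  exists 2%N, Im, M; split=> //=.
    by rewrite C0 !Hf ltNge Hab /= /step C1.
  rewrite (max_idPl Hab); case: Hr => HN Hr Hi _ Ha; split=> //= k.
  by rewrite updnE /upd; case: eqP => [->|_]; rewrite Hf.
- by move=> p _ Hc h Im M Hr; exists 0%N, Im, M; rewrite addn0.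
- move=> s1 H1 s2 H2 p /= /andP[w1 w2] /code_at_cat[].
  rewrite size_compile => /(H1 _ w1) {}H1 /(H2 _ w2) {}H2 h Im M Hr.
  have [k1 [Im1 [M1 [Hk1 He1 Hr1]]]] := H1 _ _ _ Hr.
  have [k2 [Im2 [M2 [Hk2 He2 Hr2]]]] := H2 _ _ _ Hr1.
  exists (k1 + k2)%N, Im2, M2; split=> //=; first by lia.
  by rewrite exec_add He1 He2 addnA.
- move=> a b s1 H1 s2 H2 p /= /andP[w1 w2] /code_at_cons[C0 /code_at_cat[]].
  rewrite size_compile => /(H2 _ w2) {}H2 /code_at_cons[D0].
  rewrite -addSn => /(H1 _ w1) {}H1 h Im M Hr.
  have [|k [Im' [M' [Hk He Hr']]]] :=
    simulates_if (b := fun Im M => M (reg a) < M (reg b)) _ D0 erefl erefl H2 H1 Hr.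
    by move=> *; rewrite /step C0.
  exists k, Im', M'; split=> //=; first by rewrite He; congr State; lia.
  by have [_ _ _ Hf _] := Hr; rewrite !Hf in Hr'.
- move=> a b s1 H1 s2 H2 p /= /andP[w1 w2] /code_at_cons[C0 /code_at_cat[]].
  rewrite size_compile => /(H2 _ w2) {}H2 /code_at_cons[D0].
  rewrite -addSn => /(H1 _ w1) {}H1 h Im M Hr.
  have [|k [Im' [M' [Hk He Hr']]]] :=
    simulates_if (b := fun Im M => (Im (reg a) < Im (reg b))%N) _ D0 erefl erefl H2 H1 Hr.
    by move=> *; rewrite /step C0.
  exists k, Im', M'; split=> //=; first by rewrite He; congr State; lia.
  by have [_ Hf _ _ _] := Hr; rewrite !Hf in Hr'.
- move=> i s H p /= /andP[Hw w] Hc; apply: simulates_for => //.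
  apply: H => //; move: Hc => /= /code_at_cons[_ /code_at_cons[_ /code_at_cons[_]]].
  by case/code_at_cat.
Qed.

End Simulation.
End Language.

(** * Probabilities of paths *)

Section Constraints.
Variables (R : realType) (d : nat).

(* [(q, t, b)]: the test [x_q < t] has outcome [b]. *)
Definition constr : Type := ('I_d * R * bool)%type.

Definition holds (z : 'I_d -> R) (c : constr) : bool := (z c.1.1 < c.1.2) == c.2.

Definition sat (z : 'I_d -> R) (p : seq constr) : bool := all (holds z) p.

Variable g : 'I_d -> R -> R.

(* If [I_i] is the interval cut out on coordinate [i] by [p], and [g] gives the
   distribution functions, [lower p i] and [upper p i] are the probabilities of lying
   to the left and to the right of [I_i]. *)
Fixpoint lower (p : seq constr) (i : nat) : R :=
  if p is (q, t, b) :: p' then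
    if (q == i :> nat) && ~~ b then Num.max (lower p' i) (g q t) else lower p' i
  else 0.

Fixpoint upper (p : seq constr) (i : nat) : R :=
  if p is (q, t, b) :: p' then
    if (q == i :> nat) && b then Num.max (upper p' i) (1 - g q t) else upper p' i
  else 0.

(** The mass of [I_i] is what remains beside its left and right parts; when contradictory tests make
    the interval empty, the maximum with 0 supplies the mass 0. *)
Definition len (p : seq constr) (i : nat) : R := Num.max (1 - lower p i - upper p i) 0.

(* The conditional probability of [p] given [base]; if [base] has probability 0, the
   value is a meaningless number. *)
Fixpoint cprob (base p : seq constr) : R :=
  if p is c :: p' then
    cprob base p' * len (c :: p' ++ base) c.1.1 / len (p' ++ base) c.1.1
  else 1.

Lemma lower_ge0 p i : 0 <= lower p i.
Proof. by elim: p => //= [[[q t] b] p IH]; case: ifP => // _; rewrite le_max IH. Qed.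

Lemma upper_ge0 p i : 0 <= upper p i.
Proof. by elim: p => //= [[[q t] b] p IH]; case: ifP => // _; rewrite le_max IH. Qed.

(** Concatenating paths intersects their intervals. Tabulated bounds of two nodes thus combine in
    constant time. *)
Lemma lower_cat p1 p2 i : lower (p1 ++ p2) i = Num.max (lower p1 i) (lower p2 i).
Proof.
elim: p1 => /= [|[[q t] b] p IH]; first by rewrite (max_idPr (lower_ge0 _ _)).
by case: ifP => // _; rewrite IH maxAC.
Qed.

Lemma upper_cat p1 p2 i : upper (p1 ++ p2) i = Num.max (upper p1 i) (upper p2 i).
Proof.
elim: p1 => /= [|[[q t] b] p IH]; first by rewrite (max_idPr (upper_ge0 _ _)).
by case: ifP => // _; rewrite IH maxAC.
Qed.

Lemma len_cons_neq (c : constr) p (i : nat) : c.1.1 != i :> nat -> len (c :: p) i = len p i.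
Proof. by case: c => [[q t] b] /= H; rewrite /len /= (negbTE H). Qed.

(** A further test can only raise [lower] or [upper]. This is what makes division by a vanishing
    mass harmless. *)
Lemma len_cons_eq0 c p i : len p i = 0 -> len (c :: p) i = 0.
Proof.
case: c => [[q t] b]; rewrite /len /= => H.
have {}H : 1 - lower p i - upper p i <= 0 by rewrite -H le_max lexx.
apply/max_idPr; case: b => /=; rewrite ?andbT ?andbF; case: ifP => // _.
  apply: le_trans H; rewrite lerD2l lerN2 le_max lexx //.
apply: le_trans H; rewrite lerD2r lerD2l lerN2 le_max lexx //.
Qed.

(** Induction on [p]: a new test changes only the factor of its own feature, and the quotient in
    [cprob] replaces the old factor by the new one. *)
Lemma prod_len_cprob base p :
  (\prod_(i < d) len base i) * cprob base p = \prod_(i < d) len (p ++ base) i.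
Proof.
elim: p => [|c p IH] /=; first by rewrite mulr1.
rewrite !mulrA IH (bigD1 c.1.1) //= [RHS](bigD1 c.1.1) //=.
have -> : \prod_(i < d | i != c.1.1) len (c :: p ++ base) i =
          \prod_(i < d | i != c.1.1) len (p ++ base) i.
  by apply: eq_bigr => i Hi; rewrite len_cons_neq // eq_sym.
(* If the old factor is 0, so is the new one, and both products vanish whatever the quotient is. *)
have [H|H] := eqVneq (len (p ++ base) c.1.1) 0; last by field.
by rewrite H (len_cons_eq0 _ H) !mul0r.
Qed.

End Constraints.

(** * Path probabilities as products of interval masses *)

Section BoxProbability.
Variables (R : realType) (dm : measure_display) (Omega : measurableType dm)
          (P : probability Omega R) (d : nat).
Variable Y : 'I_d -> Omega -> R.
Hypothesis mY : forall i, measurable_fun setT (Y i).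
Hypothesis indepY : forall B : 'I_d -> set R, (forall i, measurable (B i)) ->
  P [set w | forall i, B i (Y i w)] = (\prod_(i < d) P (Y i @^-1` B i))%E.

Definition gcdf (i : 'I_d) (t : R) : R := cdf_of P (Y i) t.

(** Infinite arguments represent missing end points of an interval. *)
Definition ecdf (i : 'I_d) (e : \bar R) : R := fine (P [set w | ((Y i w)%:E < e)%E]).

Lemma measurable_elt i (e : \bar R) : measurable [set w | ((Y i w)%:E < e)%E].
Proof.
case: e => [r| |].
- rewrite (_ : [set _ | _] = Y i @^-1` [set` `]-oo, r[%R]); last first.
    by apply/seteqP; split=> w /=; rewrite in_itv /= lte_fin.
  by rewrite -[X in measurable X]setTI; apply: mY.
- by rewrite (_ : [set _ | _] = setT) // -subTset => w _ /=; rewrite ltry.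
- by rewrite (_ : [set _ | _] = set0) // -subset0 => w.
Qed.

Lemma fine_prob_le A B : measurable A -> measurable B -> (A `<=` B)%classic ->
  fine (P A) <= fine (P B).
Proof.
move=> mA mB AB; rewrite fine_le ?fin_num_measure //.
by rewrite le_measure ?inE.
Qed.

Lemma ecdf_le i e1 e2 : (e1 <= e2)%E -> ecdf i e1 <= ecdf i e2.
Proof.
move=> H; apply: fine_prob_le; try exact: measurable_elt.
by move=> w /= /lt_le_trans; apply.
Qed.

(** By monotonicity, maxima may be taken over values of the distribution function instead of
    thresholds, so only these values have to be tabulated. *)
Lemma ecdf_max i e1 e2 : ecdf i (maxe e1 e2) = Num.max (ecdf i e1) (ecdf i e2).
Proof.
have [H|H] := leP e1 e2; first by rewrite (max_idPr (ecdf_le i H)).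
by rewrite (max_idPl (ecdf_le i (ltW H))).
Qed.

Lemma ecdf_min i e1 e2 : ecdf i (mine e1 e2) = Num.min (ecdf i e1) (ecdf i e2).
Proof.
have [H|H] := leP e1 e2; first by rewrite (min_idPl (ecdf_le i H)).
by rewrite (min_idPr (ecdf_le i (ltW H))).
Qed.

Lemma ecdfNy i : ecdf i -oo%E = 0.
Proof.
rewrite /ecdf (_ : [set _ | _] = set0)%classic ?measure0 //.
by rewrite -subset0 => w.
Qed.

Lemma ecdfy i : ecdf i +oo%E = 1.
Proof.
rewrite /ecdf (_ : [set _ | _] = setT)%classic ?probability_setT //.
by rewrite -subTset => w _ /=; rewrite ltry.
Qed.

Definition in_box (p : seq (constr R d)) (i : 'I_d) (z : R) : bool :=
  all (fun c : constr R d => (c.1.1 == i) ==> ((z < c.1.2) == c.2)) p.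

Definition box (p : seq (constr R d)) (i : 'I_d) : set R := [set z | in_box p i z].

(** Induction on the path: a test on feature [i] answered true replaces [hi] by its minimum with the
    threshold, one answered false replaces [lo] by its maximum with it. *)
Lemma box_interval p i : exists lo hi : \bar R,
  [/\ forall z, in_box p i z = (lo <= z%:E)%E && (z%:E < hi)%E,
      lower gcdf p i = ecdf i lo & upper gcdf p i = 1 - ecdf i hi].
Proof.
elim: p => [|[[q t] b] p [lo [hi [H1 H2 H3]]]].
  exists -oo%E, +oo%E; split; rewrite ?ecdfNy ?ecdfy ?subrr // => z.
  by rewrite leNye ltry.
have [qi|qi] := eqVneq q i; last first.
  exists lo, hi; split=> //=; last 2 first.
  - by rewrite ifF // (inj_eq val_inj) (negbTE qi).
  - by rewrite ifF // (inj_eq val_inj) (negbTE qi).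
  by move=> z; rewrite -H1 /in_box /= (negbTE qi).
subst q; case: b.
- exists lo, (mine hi t%:E); rewrite /= !eqxx /=; split=> //.
    by move=> z; rewrite lt_min lte_fin andbA -H1 /in_box /= eqb_id andbC.
  (* [upper] records the mass [1 - ecdf i hi] from [hi] on, so the minimum of end points becomes a
     maximum. *)
  rewrite H3 ecdf_min (_ : gcdf i t = ecdf i t%:E) //.
  have [A|A] := leP (ecdf i hi) (ecdf i t%:E);
    have [B|B] := leP (1 - ecdf i hi) (1 - ecdf i t%:E); lra.
- exists (maxe lo t%:E), hi; rewrite /= !eqxx /=; split=> //.
    by move=> z; rewrite ge_max lee_fin -andbA andbCA -H1 /in_box /= eqbF_neg -leNgt.
  by rewrite H2 ecdf_max.
Qed.

Lemma measurable_box p i : measurable (box p i).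
Proof.
elim: p => [|[[q t] b] p IH]; first by rewrite (_ : box _ _ = setT) //; apply/seteqP.
rewrite (_ : box _ i =
  [set z | (q == i) ==> ((z < t) == b)] `&` box p i); last first.
  by apply/seteqP; split=> z; rewrite /box /in_box /= => /andP.
apply: measurableI => //; case: (q == i) => /=; last first.
  by rewrite (_ : [set _ | _] = setT) //; apply/seteqP.
case: b.
  rewrite (_ : [set _ | _] = [set` `]-oo, t[%R]) //.
  by apply/seteqP; split=> z /=; rewrite in_itv /= eqb_id.
rewrite (_ : [set _ | _] = [set` `[t, +oo[%R]) //.
by apply/seteqP; split=> z /=; rewrite in_itv /= andbT eqbF_neg leNgt.
Qed.

Lemma prob_box p i : fine (P (Y i @^-1` box p i)) = len gcdf p i.
Proof.
have [lo [hi [H H2 H3]]] := box_interval p i.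
rewrite /len H2 H3.
have -> : (Y i @^-1` box p i = [set w | ((Y i w)%:E < hi)%E] `\` [set w | ((Y i w)%:E < lo)%E])%classic.
  apply/seteqP; split=> w; rewrite /box /= H.
    by case/andP=> ? ?; split=> //; apply/negP; rewrite -leNgt.
  by case=> -> /negP; rewrite -leNgt => ->.
(* For [lo <= hi] the two sets are nested and their masses subtract; otherwise the difference is
   empty, and monotonicity makes [1 - lower - upper] nonpositive. *)
have [Hlh|Hlh] := leP lo hi.
  rewrite measureD; try exact: measurable_elt; last by rewrite ltey_eq fin_num_measure //; exact: measurable_elt.
  rewrite (_ : _ `&` _ = [set w | ((Y i w)%:E < lo)%E])%classic; last first.
    by apply/seteqP; split=> w /= => [[]//|h]; split=> //; exact: lt_le_trans h Hlh.
  rewrite fineB ?fin_num_measure //; try exact: measurable_elt.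
  rewrite -!/(ecdf _ _) (max_idPl _); first by ring.
  have := ecdf_le i Hlh; lra.
rewrite (_ : _ `\` _ = set0)%classic; last first.
  by rewrite -subset0 => w /= [h []]; exact: lt_trans h Hlh.
rewrite measure0 (max_idPr _) //; have := ecdf_le i (ltW Hlh); lra.
Qed.

Definition reach (p : seq (constr R d)) : set Omega := [set w | sat (Y^~ w) p].

(** Grouping the tests by feature gives one condition per coordinate, the form to which independence
    applies. *)
Lemma reachE p : reach p = [set w | forall i, box p i (Y i w)]%classic.
Proof.
apply/seteqP; split=> w /=.
  move=> /allP H i; apply/allP => c /H; rewrite /holds; by case: (c.1.1 =P i) => [<-|].
by move=> H; apply/allP => c Hc; have /allP/(_ c Hc) := H c.1.1; rewrite eqxx.
Qed.

Lemma prob_reach p : P (reach p) = (\prod_(i < d) len gcdf p i)%:E.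
Proof.
rewrite reachE indepY; last by move=> i; exact: measurable_box.
rewrite -prodEFin; apply: eq_bigr => i _.
rewrite -prob_box fineK // fin_num_measure //.
by rewrite -[X in measurable X]setTI; apply: mY => //; exact: measurable_box.
Qed.

Lemma measurable_reach p : measurable (reach p).
Proof.
elim: p => [|c p IH]; first by rewrite (_ : reach _ = setT) //; apply/seteqP.
rewrite (_ : reach _ = [set w | holds (Y^~ w) c] `&` reach p)%classic; last first.
  by apply/seteqP; split=> w /= => [/andP[]//|[? ?]]; apply/andP.
apply: measurableI => //.
have := measurable_elt c.1.1 c.1.2%:E.
case: c => [[q t] [|]] /= H.
  by rewrite (_ : [set _ | _] = [set w | ((Y q w)%:E < t%:E)%E])%classic //;
    apply/seteqP; split=> w /=; rewrite /holds /= eqb_id lte_fin.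
rewrite (_ : [set _ | _] = ~` [set w | ((Y q w)%:E < t%:E)%E])%classic; first exact: measurableC.
by apply/seteqP; split=> w /=; rewrite /holds /= eqbF_neg lte_fin => /negP.
Qed.

End BoxProbability.

(** * The mean squared gap *)

Section Mean.
Variables (R : realType) (dm : measure_display) (Omega : measurableType dm)
          (P : probability Omega R).

(** Carrying integrability along with the value lets linearity be applied repeatedly without side
    conditions. *)
Definition has_mean (f : Omega -> R) (m : R) : Prop :=
  P.-integrable setT (EFin \o f) /\ (\int[P]_w (f w)%:E)%E = m%:E.

Lemma has_mean_indic A : measurable A -> has_mean (\1_A) (fine (P A)).
Proof.
move=> mA; split; last first.
  by rewrite integral_indic // setIT fineK ?fin_num_measure.
exact: integrable_indic.
Qed.

Lemma has_meanD f g m1 m2 : has_mean f m1 -> has_mean g m2 ->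
  has_mean (fun w => f w + g w) (m1 + m2).
Proof.
move=> [If Ef] [Ig Eg]; split; first exact: (integrableD measurableT If Ig).
by rewrite (integralD measurableT If Ig) Ef Eg.
Qed.

Lemma has_meanZ c f m : has_mean f m -> has_mean (fun w => c * f w) (c * m).
Proof.
move=> [If Ef]; split; first exact: (integrableZl measurableT c If).
by rewrite (integralZl measurableT If) Ef.
Qed.

Lemma has_mean_cst c : has_mean (fun=> c) c.
Proof.
have := has_meanZ c (has_mean_indic measurableT).
rewrite probability_setT /= mulr1; congr has_mean.
by apply/funext => w; rewrite indicT mulr1.
Qed.

Lemma has_mean_sum I (s : seq I) (Q : pred I) (f : I -> Omega -> R) (m : I -> R) :
  (forall i, has_mean (f i) (m i)) ->
  has_mean (fun w => \sum_(i <- s | Q i) f i w) (\sum_(i <- s | Q i) m i).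
Proof.
move=> H; elim: s => [|i s IH].
  rewrite big_nil; under [fun w => _]funext => w do rewrite big_nil.
  exact: has_mean_cst.
rewrite big_cons; under [fun w => _]funext => w do rewrite big_cons.
by case: (Q i) => //; apply: has_meanD.
Qed.

Variable d : nat.
Variable Y : 'I_d -> Omega -> R.
Hypothesis mY : forall i, measurable_fun setT (Y i).
Hypothesis indepY : forall B : 'I_d -> set R, (forall i, measurable (B i)) ->
  P [set w | forall i, B i (Y i w)] = (\prod_(i < d) P (Y i @^-1` B i))%E.

Let g := gcdf P Y.

Lemma has_mean_sat p : has_mean (fun w => (sat (Y^~ w) p)%:R) (\prod_(i < d) len g p i).
Proof.
have := has_mean_indic (measurable_reach mY p).
rewrite (prob_reach mY indepY) /=; congr has_mean.
apply/funext => w; rewrite indicE; congr (_ %:R); congr nat_of_bool.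
by apply/idP/idP; rewrite inE.
Qed.

(** Expand the square and use linearity: the product of the indicators of two paths is the indicator
    of their concatenation, whose probability is that of [p u] times the conditional one of
    [p v]. *)
Lemma mean_square_gap n (leaf : pred nat) (y : nat -> R) (p : nat -> seq (constr R d)) C :
  (\int[P]_w ((\sum_(0 <= u < n | leaf u) y u * (sat (Y^~ w) (p u))%:R - C) ^+ 2)%:E)%E
  = (\sum_(0 <= u < n | leaf u) y u * cprob g [::] (p u) *
       (\sum_(0 <= v < n | leaf v) y v * cprob g (p u) (p v) - C - C) + C * C)%:E.
Proof.
(* The empty path has probability 1, so [cprob g [::]] is the unconditional probability. *)
have prod_nil : \prod_(i < d) len g [::] i = 1.
  by rewrite big1 // => i _; rewrite /len /= !subr0 (max_idPl _).
have prodE q : \prod_(i < d) len g q i = cprob g [::] q.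
  by rewrite -[q in LHS]cats0 -prod_len_cprob prod_nil mul1r.
(* The right-hand side is the mean of the expanded integrand, which is compared with the square
   pointwise afterwards. *)
have [_ <-] : has_mean (fun w =>
    \sum_(0 <= u < n | leaf u) (y u *
       (\sum_(0 <= v < n | leaf v) y v * (sat (Y^~ w) (p v ++ p u))%:R
        + (- C - C) * (sat (Y^~ w) (p u))%:R)) + C * C)
  (\sum_(0 <= u < n | leaf u) y u * cprob g [::] (p u) *
       (\sum_(0 <= v < n | leaf v) y v * cprob g (p u) (p v) - C - C) + C * C).
  apply: has_meanD; last exact: has_mean_cst.
  have := @has_mean_sum _ (index_iota 0 n) leaf (fun u w => (y u *
       (\sum_(0 <= v < n | leaf v) y v * (sat (Y^~ w) (p v ++ p u))%:R
        + (- C - C) * (sat (Y^~ w) (p u))%:R)))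
    (fun u => y u * (\sum_(0 <= v < n | leaf v) y v * (\prod_(i < d) len g (p v ++ p u) i) + (- C - C) * (\prod_(i < d) len g (p u) i))).
  move=> /(_ _)/wrap[].
    move=> u; apply: has_meanZ; apply: has_meanD.
      by apply: has_mean_sum => v; apply: has_meanZ; exact: has_mean_sat.
    by apply: has_meanZ; exact: has_mean_sat.
  congr has_mean; apply: eq_bigr => u _.
  rewrite -mulrA; congr (_ * _).
  rewrite -addrA [RHS]mulrDr mulr_sumr prodE [X in _ + X]mulrC; congr (_ + _).
  by apply: eq_bigr => v _; rewrite -prod_len_cprob prodE; ring.
apply: eq_integral => w _; congr (_%:E).
set a := fun u => (sat (Y^~ w) (p u))%:R : R.
have -> : \sum_(0 <= u < n | leaf u) y u * (sat (Y^~ w) (p u))%:R =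
          \sum_(0 <= u < n | leaf u) y u * a u by [].
have -> : \sum_(0 <= u < n | leaf u) y u *
     (\sum_(0 <= v < n | leaf v) y v * (sat (Y^~ w) (p v ++ p u))%:R +
      (- C - C) * (sat (Y^~ w) (p u))%:R) =
  \sum_(0 <= u < n | leaf u) (y u * a u) *
     (\sum_(0 <= v < n | leaf v) y v * a v - C - C).
  apply: eq_bigr => u _; rewrite -mulrA; congr (_ * _).
  rewrite -[in RHS]addrA [RHS]mulrDr mulr_sumr [X in _ + X]mulrC; congr (_ + _).
  by apply: eq_bigr => v _; rewrite /sat all_cat -/(sat _ _) -mulnb natrM /a /sat; ring.
(* With s the common sum, this is [(s - C)^2 = s (s - C - C) + C C]. *)
by rewrite -mulr_suml; ring.
Qed.

End Mean.

Lemma big_setIP (T : Type) (I : finType) (Q : pred I) (F : I -> set T) (w : T) :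
  (\big[setI/setT]_(i | Q i) F i) w <-> forall i, Q i -> F i w.
Proof.
split=> [H i Qi|H]; first by move: H; rewrite (bigD1 i) //= => -[].
by elim/big_ind: _ => // i; exact: H.
Qed.

(** * Coordinates of the perturbed input *)

Section Perturbed.
Variables (R : realType) (dm : measure_display) (Omega : measurableType dm)
          (P : probability Omega R) (d : nat).
Variables (x : 'I_d -> R) (S : {set 'I_d}) (delta : 'I_d -> {RV P >-> R}).
Let Y (i : 'I_d) (w : Omega) := perturbed x S (fun i => delta i : Omega -> R) w i.

Lemma measurable_perturbed i : measurable_fun setT (Y i).
Proof.
rewrite /Y /perturbed; case: (i \in S); last exact: measurable_cst.
by apply: measurable_funD => //; exact: measurable_cst.
Qed.

(** Outside [S] the law is the point mass at [x i], whose distribution function is a step. *)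
Lemma perturbed_gcdf i t :
  gcdf P Y i t =
  if i \in S then cdf_of P (delta i) (t - x i) else (x i < t)%R%:R.
Proof.
rewrite /gcdf /cdf_of /Y /perturbed; case: (i \in S).
  by congr (fine (P _)); apply/seteqP; split=> w /=; rewrite ltrBrDl.
case: (x i < t).
  by rewrite (_ : [set _ | _] = setT) ?probability_setT //; apply/seteqP.
by rewrite (_ : [set _ | _] = set0) ?measure0 // -subset0.
Qed.

(** A coordinate outside [S] is constant, so its condition is surely true or surely false; the
    coordinates in [S] are translates of the [delta i], and the sets are translated back. *)
Lemma indep_perturbed : mutually_independent P S (fun i => delta i : Omega -> R) ->
  forall B : 'I_d -> set R, (forall i, measurable (B i)) ->
  P [set w | forall i, B i (Y i w)] = (\prod_(i < d) P (Y i @^-1` B i))%E.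
Proof.
move=> H B mB.
(* If a constant coordinate violates its condition, both sides are 0. *)
have [[j jS nB]|HB] := pselect (exists2 j, j \notin S & ~ B j (x j)).
  rewrite (bigD1 j) //= (_ : [set _ | _] = set0); last first.
    by rewrite -subset0 => w /(_ j); rewrite /Y /perturbed (negbTE jS).
  rewrite (_ : _ @^-1` _ = set0) ?measure0 ?mul0e //.
  by rewrite -subset0 => w; rewrite /Y /perturbed /= (negbTE jS).
have {}HB j : j \notin S -> B j (x j).
  by move=> jS; apply: contrapT => nB; apply: HB; exists j.
pose B' i := [set z | B i (x i + z)].
have mB' i : measurable (B' i).
  rewrite -[X in measurable X]setTI.
  by apply: (measurable_funD (measurable_cst (x i)) (@measurable_id _ _ setT)).
have YS i : i \in S -> Y i @^-1` B i = delta i @^-1` B' i.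
  by move=> iS; rewrite /Y /perturbed /B' iS.
have E := H B' mB'.
rewrite (bigID (mem S)) /= [X in (_ * X)%E]big1 ?mule1; last first.
  move=> i iS; rewrite (_ : _ @^-1` _ = setT) ?probability_setT //.
  by rewrite -subTset => w _ /=; rewrite /Y /perturbed (negbTE iS); exact: HB.
rewrite (eq_bigr (fun i => P (delta i @^-1` B' i))); last by move=> i /YS ->.
rewrite -E; congr (P _).
apply/seteqP; split=> w /=.
  move=> Hw; apply/big_setIP => i iS; rewrite -YS //; exact: Hw.
move/big_setIP => Hw i; have [iS|iS] := boolP (i \in S).
  by have := Hw i iS; rewrite -YS.
by rewrite /Y /perturbed (negbTE iS); exact: HB.
Qed.

End Perturbed.

(** * The program *)

Arguments den : simpl never.

Definition seqs : seq cmd -> cmd := foldr CSeq CSkip.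

(* Integer registers: [rU] and [rV] hold the current nodes u and v, [rQ], [rA], [rB] the
   feature and the children of a node, [rUU] and [rVN] table indices of the form
   u * n + u and v * n; [rZ] always holds 0. *)
Notation rU := 0%N.
Notation rV := 1%N.
Notation rQ := 2%N.
Notation rA := 3%N.
Notation rB := 4%N.
Notation rF := 5%N.
Notation rZ := 6%N.
Notation rUU := 7%N.
Notation rVN := 8%N.
Notation rI := 9%N.
(* Real registers: [fOne] and [fZero] are constants, [fC] is the distribution function at
   the threshold of the current node, [fL] and [fH] are [lower] and [upper] for its
   feature, [fF] accumulates f(x). *)
Notation fOne := 0%N.
Notation fZero := 1%N.
Notation fC := 2%N.
Notation fK := 3%N.
Notation fL := 4%N.
Notation fH := 5%N.
Notation fLA := 6%N.
Notation fLB := 7%N.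
Notation fLen := 8%N.
Notation fP := 9%N.
Notation fT := 10%N.
Notation fX := 11%N.
Notation fC0 := 12%N.
Notation fY := 13%N.
Notation fF := 14%N.
Notation fAcc := 15%N.
Notation fSum := 16%N.

(* Arrays 0 and 1 are input. At index w * n + u, arrays 2 and 3 hold [lower] and [upper]
   for the path of u and the feature of w. At index u, array 4 holds the distribution
   function at the threshold of u, array 5 the probability of not reaching u, and array 6
   the indicator of x not reaching u (phase 1), then the conditional probability of not
   reaching u given the current leaf (phase 2). Complements are stored because the roots
   are never written to and the memory initially holds 0. *)
Definition split_len : cmd := seqs
  [:: COp OSub fK fOne fC;
      COp OAdd fLA fH fZero; CMax fLA fK;
      COp OSub fLen fOne fL; COp OSub fLA fLen fLA; CMax fLA fZero;
      COp OAdd fLB fL fZero; CMax fLB fC;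
      COp OSub fLB fOne fLB; COp OSub fLB fLB fH; CMax fLB fZero;
      COp OSub fLen fLen fH; CMax fLen fZero].

(** One step of [cprob] for both children: the stored complement is undone, the value is multiplied
    by the mass of the part over that of the whole, and complements are stored again. *)
Definition push (c i : nat) : cmd := seqs
  [:: CGet fP c i; COp OSub fP fOne fP;
      COp OMul fLA fP fLA; COp ODiv fLA fLA fLen; COp OSub fLA fOne fLA; CPut c rA fLA;
      COp OMul fLB fP fLB; COp ODiv fLB fLB fLen; COp OSub fLB fOne fLB; CPut c rB fLB].

Definition load_node : cmd := seqs
  [:: CField rQ 1 rU; CField rA 2 rU; CField rB 3 rU; CGet fT 0 rU; CGet fX 1 rQ].

Definition test_x : cmd :=
  CIfR fX fT (COp OAdd fC0 fOne fZero) (COp OAdd fC0 fZero fZero).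

(** Outside [S] the indicator of the test at [x] already is the distribution function of the
    coordinate at the threshold. *)
Definition node_cdf : cmd := seqs
  [:: CField rF 5 rQ;
      CIfI rZ rF (CSeq (COp OSub fC fT fX) (CCdf fC rQ fC)) (COp OAdd fC fC0 fZero)].

Definition load_interval : cmd := seqs
  [:: CPut 4 rU fC; CGet fL 2 rUU; CGet fH 3 rUU].

Definition node_prefix : cmd := seqs [:: load_node; test_x; node_cdf; load_interval].

Definition push_indicator : cmd := seqs
  [:: CGet fP 6 rU; COp OSub fP fOne fP; COp OMul fLA fP fC0; COp OSub fLB fP fLA;
      COp OSub fLA fOne fLA; CPut 6 rA fLA; COp OSub fLB fOne fLB; CPut 6 rB fLB].

(** Equality of features is the failure of both strict comparisons. The left child has its [upper]
    raised, the right child its [lower]. *)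
Definition refine_if_same : cmd :=
  CIfI rF rQ CSkip (CIfI rQ rF CSkip (CSeq (CMax fLA fK) (CMax fLB fC))).

(** Rows are indexed by nodes standing for their features, which keeps the tables of size n by n
    whatever [d] is. *)
Definition row_body : cmd := seqs
  [:: CAdd rI rVN rU; CGet fL 2 rI; CGet fH 3 rI;
      COp OAdd fLA fH fZero; COp OAdd fLB fL fZero;
      CField rF 1 rV; refine_if_same;
      CAdd rI rVN rA; CPut 2 rI fL; CPut 3 rI fLA;
      CAdd rI rVN rB; CPut 2 rI fLB; CPut 3 rI fH;
      CAddN rVN rVN].

Definition rows : cmd := CSeq (CSet rVN 0) (CFor rV row_body).

Definition inner_node : cmd := seqs
  [:: node_prefix; split_len; push 5 rU; push_indicator; rows].

Definition leaf_value : cmd := seqs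
  [:: CGet fY 0 rU; CGet fP 6 rU; COp OSub fP fOne fP; COp OMul fY fY fP;
      COp OAdd fF fF fY].

(** The machine does not multiply integers, so the diagonal index moves on by n + 1. *)
Definition next_diag : cmd := seqs
  [:: CSet rI 1; CAdd rUU rUU rI; CAddN rUU rUU].

Definition phase1_body : cmd := seqs
  [:: CField rF 0 rU; CIfI rZ rF leaf_value inner_node; next_diag].

Definition pair_leaf : cmd := seqs
  [:: CGet fY 0 rV; CGet fP 6 rV; COp OSub fP fOne fP; COp OMul fY fY fP;
      COp OAdd fSum fSum fY].

(** Here [rUU] runs along the diagonal of v. Row v holds, in columns v and u, the bounds of both
    paths for the feature of v. *)
Definition pair_prefix : cmd := seqs
  [:: CField rA 2 rV; CField rB 3 rV; CGet fC 4 rV;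
      CAdd rI rVN rU; CGet fL 2 rUU; CGet fH 3 rUU;
      CGet fX 2 rI; CGet fT 3 rI; CMax fL fX; CMax fH fT].

Definition pair_inner : cmd := seqs [:: pair_prefix; split_len; push 6 rV].

Definition pair_body : cmd := seqs
  [:: CField rF 0 rV; CIfI rZ rF pair_leaf pair_inner; CAddN rVN rVN; next_diag].

(** The inner sum starts at -2 C, which supplies the linear term of the expanded square. *)
Definition phase2_init : cmd := seqs
  [:: COp OSub fSum fZero fF; COp OSub fSum fSum fF; CSet rVN 0; CSet rUU 0].

Definition phase2_add : cmd := seqs
  [:: CGet fY 0 rU; CGet fP 5 rU; COp OSub fP fOne fP; COp OMul fY fY fP;
      COp OMul fY fY fSum; COp OAdd fAcc fAcc fY].

Definition phase2_leaf : cmd := seqs [:: phase2_init; CFor rV pair_body; phase2_add].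

Definition phase2_body : cmd := seqs
  [:: CField rF 0 rU; CIfI rZ rF phase2_leaf CSkip].

(** Index 0 of array 0 is real cell 0, where the result is expected. *)
Definition finish : cmd := seqs
  [:: COp OMul fF fF fF; COp OAdd fAcc fAcc fF; CPut 0 rZ fAcc].

Definition pg2_cmd : cmd := seqs
  [:: CConst fOne 1; CFor rU phase1_body; CFor rU phase2_body; finish].

Lemma wf_pg2_cmd : wf_cmd pg2_cmd.
Proof. by []. Qed.

(** Loops nest to depth two only, so the cost is an explicit quadratic polynomial in n. *)
Lemma cost_pg2_cmd n : (cost n pg2_cmd <= 2000 * n ^ 2 + 2000)%N.
Proof. rewrite /=; nia. Qed.

(* Call by need: [simpl] copies the nested stores exponentially often. *)
Ltac run := lazy beta iota zeta delta
  [seqs foldr den set_rreg set_ireg set_arr updn eqn ireg rreg arr rop_fun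
   split_len push load_node load_interval push_indicator leaf_value next_diag
   pair_leaf test_x node_cdf node_prefix refine_if_same row_body pair_prefix phase2_init phase2_add finish];
  fold eqn.

(** * Effect of the basic blocks on a store *)

Section Execution.
Variables (R : realType) (oracle : nat -> R -> R) (n : nat) (inp : nat -> nat -> nat).
Notation den := (den oracle n inp).

Lemma ireg_set (h : store R) a v r :
  ireg (set_ireg h a v) r = if r == a then v else ireg h r.
Proof. by []. Qed.

Lemma ireg_set_neq (h : store R) a v r :
  r != a -> ireg (set_ireg h a v) r = ireg h r.
Proof. by rewrite ireg_set => /negbTE->. Qed.

Lemma rreg_set (h : store R) a v : rreg (set_ireg h a v) = rreg h.
Proof. by []. Qed.

Lemma arr_set (h : store R) a v : arr (set_ireg h a v) = arr h.
Proof. by []. Qed.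

(** Invariant rule: since the body never assigns the index register, its value is the number of
    completed rounds. *)
Lemma den_for i s (Inv : nat -> store R -> Prop) h :
  i \notin iregs s -> Inv 0%N (set_ireg h i 0%N) ->
  (forall k h, (k < n)%N -> ireg h i = k -> Inv k h ->
     Inv k.+1 (set_ireg (den s h) i k.+1)) ->
  Inv n (den (CFor i s) h).
Proof.
move=> Hw H0 HS.
pose body h1 := set_ireg (den s h1) i (ireg (den s h1) i).+1.
rewrite -[den (CFor i s) h]/(iter n body (set_ireg h i 0%N)).
suff H k : (k <= n)%N -> let h' := iter k body (set_ireg h i 0%N) in
    ireg h' i = k /\ Inv k h'.
  by case: (H n (leqnn n)).
elim: k => [|k IH] Hk /=; first by rewrite updnE /upd eqxx.
have [Hi HI] := IH (ltnW Hk).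
by rewrite /body den_ireg // Hi; split; [rewrite /= updnE /upd eqxx | exact: HS].
Qed.

Lemma den_split_len (h : store R) : rreg h fZero = 0 -> rreg h fOne = 1 ->
  let h' := den split_len h in
  [/\ rreg h' fLA = Num.max (1 - rreg h fL - Num.max (rreg h fH) (1 - rreg h fC)) 0,
      rreg h' fLB = Num.max (1 - Num.max (rreg h fL) (rreg h fC) - rreg h fH) 0,
      rreg h' fLen = Num.max (1 - rreg h fL - rreg h fH) 0 &
      rreg h' fK = 1 - rreg h fC].
Proof. by case: h => i r m; run => h0 h1; rewrite !h0 !h1 !addr0. Qed.

Lemma den_push (h : store R) c i k : rreg h fOne = 1 ->
  let p := (1 - arr h c (ireg h i)) in
  arr (den (push c i) h) c k =
    if k == ireg h rB then 1 - p * rreg h fLB / rreg h fLen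
    else if k == ireg h rA then 1 - p * rreg h fLA / rreg h fLen
    else arr h c k.
Proof.
case: h => j r m; run => h1; rewrite !h1 !eqnE eqxx.
by case: ifP => // _; case: ifP.
Qed.

Lemma den_push_indicator (h : store R) k : rreg h fOne = 1 ->
  let p := (1 - arr h 6 (ireg h rU)) in
  arr (den push_indicator h) 6 k =
    if k == ireg h rB then 1 - (p - p * rreg h fC0)
    else if k == ireg h rA then 1 - p * rreg h fC0
    else arr h 6 k.
Proof. by case: h => j r m; run => h1; rewrite !h1 !eqnE. Qed.

Lemma den_node_prefix (h : store R) (q : nat) (t : R) :
  rreg h fOne = 1 -> rreg h fZero = 0 -> ireg h rZ = 0%N ->
  inp 1 (ireg h rU) = q -> arr h 0 (ireg h rU) = t ->
  let h' := den node_prefix h in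
  let b := arr h 1 q < t in
  let c := if (0 < inp 5 q)%N then oracle q (t - arr h 1 q) else b%:R in
  [/\ ireg h' rQ = q, ireg h' rA = inp 2 (ireg h rU), ireg h' rB = inp 3 (ireg h rU),
      rreg h' fC0 = b%:R & rreg h' fC = c] /\
  [/\ rreg h' fL = arr h 2 (ireg h rUU), rreg h' fH = arr h 3 (ireg h rUU)
    & forall k, arr h' 4 k = if k == ireg h rU then c else arr h 4 k].
Proof.
case: h => i r m; run => h1 h0 hz Hq Ht.
rewrite !Hq !Ht.
by case: (m 1%N q < t); run; rewrite !hz; case: (0 < inp 5 q)%N;
  run; rewrite ?Hq ?Ht ?h1 ?h0 ?addr0; split; split=> // k; rewrite eqnE.
Qed.

Lemma index_inj w w' j j' : (j < n)%N -> (j' < n)%N ->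
  (w * n + j == w' * n + j')%N = (w == w') && (j == j').
Proof.
move=> Hj Hj'; apply/eqP/andP => [E|[/eqP-> /eqP->]//].
have n0 : (0 < n)%N by lia.
have Ew : w = w'.
  have := congr1 (divn^~ n) E.
  by rewrite /= !divnMDl // !divn_small // !addn0.
by split; apply/eqP => //; subst w'; lia.
Qed.

Lemma den_row_body (h : store R) :
  rreg h fZero = 0 -> rreg h fK = 1 - rreg h fC ->
  let h' := den row_body h in
  let v := ireg h rVN in
  let l := arr h 2 (v + ireg h rU)%N in let u := arr h 3 (v + ireg h rU)%N in
  let same := inp 1 (ireg h rV) == ireg h rQ in
  [/\ ireg h' rVN = (v + n)%N,
      forall k, arr h' 2 k =
        if k == (v + ireg h rB)%N then (if same then Num.max l (rreg h fC) else l)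
        else if k == (v + ireg h rA)%N then l else arr h 2 k
    & forall k, arr h' 3 k =
        if k == (v + ireg h rB)%N then u
        else if k == (v + ireg h rA)%N then (if same then Num.max u (1 - rreg h fC) else u)
        else arr h 3 k].
Proof.
case: h => i r m; run => h0 hK.
have -> : (inp 1%N (i 1%N) == i 2%N) =
  ~~ (inp 1%N (i 1%N) < i 2%N)%N && ~~ (i 2%N < inp 1%N (i 1%N))%N.
  by rewrite -!leqNgt eqn_leq andbC.
rewrite !h0 !addr0 hK.
by case: ifP => H1 /=; last case: ifP => H2 /=; run; split=> // k; rewrite !eqnE.
Qed.

(** Both children have larger numbers than u, so column u, from which each row is computed, is never
    overwritten. *)
Lemma den_rows (h : store R) (u a b : nat) (q : nat) :
  rreg h fZero = 0 -> rreg h fK = 1 - rreg h fC ->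
  ireg h rU = u -> ireg h rA = a -> ireg h rB = b -> ireg h rQ = q ->
  (u < a < n)%N -> (u < b < n)%N ->
  let h' := den rows h in
  forall w j, (w < n)%N -> (j < n)%N ->
  let l := arr h 2 (w * n + u)%N in let e := arr h 3 (w * n + u)%N in
  arr h' 2 (w * n + j)%N =
    (if j == b then (if inp 1 w == q then Num.max l (rreg h fC) else l)
     else if j == a then l else arr h 2 (w * n + j)%N) /\
  arr h' 3 (w * n + j)%N =
    (if j == b then e
     else if j == a then (if inp 1 w == q then Num.max e (1 - rreg h fC) else e)
     else arr h 3 (w * n + j)%N).
Proof.
move=> h0 hK hU hA hB hQ Ha Hb h' w j Hw Hj l e.
(* After k rounds, the rows below k are updated and the others are still those of [h]. *)
pose Inv k (h1 : store R) := [/\ ireg h1 rVN = (k * n)%N,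
  forall r, r \notin iregs rows -> ireg h1 r = ireg h r,
  forall r, r \notin rregs rows -> rreg h1 r = rreg h r &
  forall w j, (w < n)%N -> (j < n)%N ->
  let l := arr h 2 (w * n + u)%N in let e := arr h 3 (w * n + u)%N in
  arr h1 2 (w * n + j)%N =
    (if (w < k)%N && (j == b) then (if inp 1 w == q then Num.max l (rreg h fC) else l)
     else if (w < k)%N && (j == a) then l else arr h 2 (w * n + j)%N) /\
  arr h1 3 (w * n + j)%N =
    (if (w < k)%N && (j == b) then e
     else if (w < k)%N && (j == a) then (if inp 1 w == q then Num.max e (1 - rreg h fC) else e)
     else arr h 3 (w * n + j)%N)].
suff [_ _ _ /(_ w j Hw Hj)] : Inv n h' by rewrite Hw.
rewrite /h' -[den rows h]/(den (CFor rV row_body) (den (CSet rVN 0) h)).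
apply: (den_for (Inv := Inv)) => //.
  split=> //= r; rewrite !inE !negb_or => /andP[/negbTE Hr1 /andP[/negbTE Hr2 _]].
  by rewrite !updnE /upd Hr1 Hr2.
move=> k h1 Hk Hv [HVN Hi Hr Harr].
have Z1 : rreg h1 fZero = 0 by rewrite Hr.
have K1 : rreg h1 fK = 1 - rreg h1 fC by rewrite !Hr.
have [V2 A2 A3] := den_row_body Z1 K1.
move: V2 A2 A3; rewrite !HVN Hv !(Hr fC isT) !(Hi rU isT) !(Hi rA isT) !(Hi rB isT) !(Hi rQ isT) hU hA hB hQ => V2 A2 A3.
split.
- by rewrite ireg_set_neq // V2 mulSnr.
- move=> r Hnr; rewrite ireg_set; case: eqP => [E|_]; first by move: Hnr; rewrite E.
  by rewrite den_ireg ?Hi //; move: Hnr; rewrite /rows /= !inE !negb_or => /andP[_ /andP[]].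
- by move=> r Hnr; rewrite rreg_set den_rreg ?Hr.
- move=> w' j' Hw' Hj' l' e'.
  have un : (u < n)%N by lia.
  have [an bn] : (a < n)%N /\ (b < n)%N by lia.
  have na : (u == a) = false by lia.
  have nb : (u == b) = false by lia.
  have [B2 B3] := Harr w' j' Hw' Hj'.
  have [C2 C3] := Harr k u Hk un.
  rewrite arr_set A2 A3 B2 B3 C2 C3 !index_inj // ltnn /=.
  have -> : (w' < k.+1)%N = (w' == k) || (w' < k)%N by rewrite ltnS leq_eqVlt.
  case: (w' =P k) => [Ew|_] //=; rewrite /l' /e' Ew ltnn; by case: (j' == b); case: (j' == a).
Qed.

End Execution.

(** * An inner node in the first pass *)

Section InnerNode.
Variables (R : realType) (oracle : nat -> R -> R) (n : nat) (inp : nat -> nat -> nat).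
Notation den := (den oracle n inp).

Lemma den_seqs_cons s l h : den (seqs (s :: l)) h = den (seqs l) (den s h).
Proof. by []. Qed.

Lemma den_nil h : den (seqs [::]) h = h.
Proof. by []. Qed.

(* For an interval with [lower = l], [upper = e], cut at a point with distribution
   function [c]: the probabilities of its two parts and of the whole. *)
Definition left_len (l e c : R) := Num.max (1 - l - Num.max e (1 - c)) 0.
Definition right_len (l e c : R) := Num.max (1 - Num.max l c - e) 0.
Definition cur_len (l e : R) := Num.max (1 - l - e) 0.

Lemma den_inner_node (h : store R) (u a b q : nat) (t : R) :
  rreg h fOne = 1 -> rreg h fZero = 0 -> ireg h rZ = 0%N ->
  ireg h rU = u -> ireg h rUU = (u * n + u)%N ->
  inp 1 u = q -> inp 2 u = a -> inp 3 u = b -> arr h 0 u = t ->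
  (u < a < n)%N -> (u < b < n)%N ->
  let h' := den inner_node h in
  let x_left := arr h 1 q < t in
  let c := if (0 < inp 5 q)%N then oracle q (t - arr h 1 q) else x_left%:R in
  let l := arr h 2 (u * n + u)%N in let e := arr h 3 (u * n + u)%N in
  let p := 1 - arr h 5 u in let r := 1 - arr h 6 u in
  [/\ forall k, arr h' 4 k = if k == u then c else arr h 4 k,
      forall k, arr h' 5 k =
        if k == b then 1 - p * right_len l e c / cur_len l e
        else if k == a then 1 - p * left_len l e c / cur_len l e else arr h 5 k,
      forall k, arr h' 6 k =
        if k == b then 1 - (r - r * x_left%:R)
        else if k == a then 1 - r * x_left%:R else arr h 6 k
    & forall w j, (w < n)%N -> (j < n)%N ->
      let l := arr h 2 (w * n + u)%N in let e := arr h 3 (w * n + u)%N in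
      arr h' 2 (w * n + j)%N =
        (if j == b then (if inp 1 w == q then Num.max l c else l)
         else if j == a then l else arr h 2 (w * n + j)%N) /\
      arr h' 3 (w * n + j)%N =
        (if j == b then e
         else if j == a then (if inp 1 w == q then Num.max e (1 - c) else e)
         else arr h 3 (w * n + j)%N)].
Proof.
move=> h1 h0 hz hU hUU Hq Ha Hb Ht lta ltb h' x_left c l e p r.
have := @den_node_prefix _ oracle n inp h q t h1 h0 hz.
rewrite !hU Ha Hb hUU => /(_ Hq Ht) [[Q1 A1 B1 X1 C1] [L1 E1 M1]].
rewrite -/c -/x_left in C1 X1 M1.
rewrite /h' /inner_node 5!den_seqs_cons den_nil.
(* [s1] to [s4] are the stores after successive blocks; the frame rules trace each value back to the
   block that last wrote it. *)
set s1 := den node_prefix h in Q1 A1 B1 X1 C1 L1 E1 M1 *.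
have s1_1 : rreg s1 fOne = 1 by rewrite den_rreg.
have s1_0 : rreg s1 fZero = 0 by rewrite den_rreg.
have [] := @den_split_len _ oracle n inp s1 s1_0 s1_1.
rewrite L1 E1 C1 => LA2 LB2 LEN2 K2.
set s2 := den split_len s1 in LA2 LB2 LEN2 K2 *.
have s2_1 : rreg s2 fOne = 1 by rewrite den_rreg.
have P3 := fun k => @den_push _ oracle n inp s2 5 rU k s2_1.
set s3 := den (push 5 rU) s2 in P3 *.
have s3_1 : rreg s3 fOne = 1 by rewrite den_rreg.
have P4 := fun k => @den_push_indicator _ oracle n inp s3 k s3_1.
set s4 := den push_indicator s3 in P4 *.
have Ireg k : k \notin iregs node_prefix -> ireg s1 k = ireg h k by exact: den_ireg.
have I2 k : ireg s2 k = ireg s1 k by apply: den_ireg.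
have I3 k : ireg s3 k = ireg s1 k by rewrite -I2; apply: den_ireg.
have I4 k : ireg s4 k = ireg s1 k by rewrite -I3; apply: den_ireg.
have U1 : ireg s1 rU = u by rewrite Ireg.
have R43 r0 : r0 \notin rregs push_indicator -> rreg s4 r0 = rreg s3 r0.
  exact: den_rreg.
have R32 r0 : r0 \notin rregs (push 5 rU) -> rreg s3 r0 = rreg s2 r0.
  exact: den_rreg.
have R21 r0 : r0 \notin rregs split_len -> rreg s2 r0 = rreg s1 r0.
  exact: den_rreg.
have C4 : rreg s4 fC = c by rewrite R43 // R32 // R21.
have Z4 : rreg s4 fZero = 0 by rewrite R43 // R32 // R21.
have K4 : rreg s4 fK = 1 - rreg s4 fC.
  by rewrite C4 -K2 R43 // R32.
have X4 : rreg s3 fC0 = x_left%:R by rewrite R32 // R21.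
have := @den_rows _ oracle n inp s4 u a b q Z4 K4.
rewrite !I4 => /(_ U1 A1 B1 Q1 lta ltb); rewrite C4 => RW.
have M10 k : k \notin chans node_prefix -> arr s1 k = arr h k by exact: den_arr.
have M21 k : arr s2 k = arr s1 k by apply: den_arr.
have M32 k : k != 5%N -> arr s3 k = arr s2 k.
  by move=> Hk; apply: den_arr; rewrite /= mem_seq2 negb_or Hk.
have M43 k : k != 6%N -> arr s4 k = arr s3 k.
  by move=> Hk; apply: den_arr; rewrite /= mem_seq2 negb_or Hk.
have M54 k : k \notin chans rows -> arr (den rows s4) k = arr s4 k by exact: den_arr.
have F2 : arr s4 2 = arr h 2 by rewrite M43 // M32 // M21 M10.
have F3 : arr s4 3 = arr h 3 by rewrite M43 // M32 // M21 M10.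
rewrite F2 F3 in RW.
split=> //.
- by move=> k; rewrite M54 // M43 // M32 // M21.
- by move=> k; rewrite M54 // M43 // P3 !I2 U1 A1 B1 LA2 LB2 LEN2 M21 M10.
- by move=> k; rewrite M54 // P4 !I3 U1 A1 B1 X4 M32 // M21 M10.
Qed.

End InnerNode.

(** * Leaves, pairs of nodes and the accumulators *)

Section Blocks.
Variables (R : realType) (oracle : nat -> R -> R) (n : nat) (inp : nat -> nat -> nat).
Notation den := (den oracle n inp).

Lemma den_leaf_value (h : store R) : rreg h fOne = 1 ->
  rreg (den leaf_value h) fF =
  rreg h fF + arr h 0 (ireg h rU) * (1 - arr h 6 (ireg h rU)).
Proof. by case: h => i r m; run => ->. Qed.

Lemma den_next_diag (h : store R) k :
  ireg h rUU = (k * n + k)%N -> ireg (den next_diag h) rUU = (k.+1 * n + k.+1)%N.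
Proof. by case: h => i r m; run => ->; rewrite mulSn; lia. Qed.

Lemma den_pair_leaf (h : store R) : rreg h fOne = 1 ->
  rreg (den pair_leaf h) fSum =
  rreg h fSum + arr h 0 (ireg h rV) * (1 - arr h 6 (ireg h rV)).
Proof. by case: h => i r m; run => ->. Qed.

Lemma den_pair_prefix (h : store R) :
  let h' := den pair_prefix h in
  let v := ireg h rV in
  [/\ ireg h' rA = inp 2 v, ireg h' rB = inp 3 v, rreg h' fC = arr h 4 v,
      rreg h' fL = Num.max (arr h 2 (ireg h rUU)) (arr h 2 (ireg h rVN + ireg h rU)%N)
    & rreg h' fH = Num.max (arr h 3 (ireg h rUU)) (arr h 3 (ireg h rVN + ireg h rU)%N)].
Proof. by case: h => i r m; run. Qed.

Lemma den_pair_inner (h : store R) (v a b : nat) :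
  rreg h fOne = 1 -> rreg h fZero = 0 -> ireg h rV = v ->
  inp 2 v = a -> inp 3 v = b ->
  let l := Num.max (arr h 2 (ireg h rUU)) (arr h 2 (ireg h rVN + ireg h rU)%N) in
  let e := Num.max (arr h 3 (ireg h rUU)) (arr h 3 (ireg h rVN + ireg h rU)%N) in
  let c := arr h 4 v in let p := 1 - arr h 6 v in
  forall k, arr (den pair_inner h) 6 k =
    if k == b then 1 - p * right_len l e c / cur_len l e
    else if k == a then 1 - p * left_len l e c / cur_len l e else arr h 6 k.
Proof.
move=> h1 h0 hV Ha Hb l e c p k.
rewrite /pair_inner 3!den_seqs_cons den_nil.
have [] := den_pair_prefix h; rewrite !hV Ha Hb -/l -/e -/c => A1 B1 C1 L1 E1.
set s1 := den pair_prefix h in A1 B1 C1 L1 E1 *.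
have s1_1 : rreg s1 fOne = 1 by rewrite den_rreg.
have s1_0 : rreg s1 fZero = 0 by rewrite den_rreg.
have [] := @den_split_len _ oracle n inp s1 s1_0 s1_1.
rewrite L1 E1 C1 => LA2 LB2 LEN2 _.
set s2 := den split_len s1 in LA2 LB2 LEN2 *.
have s2_1 : rreg s2 fOne = 1 by rewrite den_rreg.
have I2 r : ireg s2 r = ireg s1 r by apply: den_ireg.
have V1 : ireg s1 rV = v by rewrite den_ireg.
have M2 : arr s2 6 = arr h 6.
  have -> : arr s2 6 = arr s1 6 by apply: den_arr.
  exact: den_arr.
by rewrite den_push // !I2 V1 A1 B1 LA2 LB2 LEN2 M2.
Qed.

Lemma den_phase2_init (h : store R) : rreg h fZero = 0 ->
  let h' := den phase2_init h in
  [/\ rreg h' fSum = - rreg h fF - rreg h fF, ireg h' rVN = 0%N & ireg h' rUU = 0%N].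
Proof. by case: h => i r m; run => ->; rewrite sub0r. Qed.

Lemma den_phase2_add (h : store R) : rreg h fOne = 1 ->
  rreg (den phase2_add h) fAcc = rreg h fAcc +
    arr h 0 (ireg h rU) * (1 - arr h 5 (ireg h rU)) * rreg h fSum.
Proof. by case: h => i r m; run => ->. Qed.

Lemma den_finish (h : store R) : ireg h rZ = 0%N ->
  arr (den finish h) 0 0%N = rreg h fAcc + rreg h fF * rreg h fF.
Proof. by case: h => i r m; run => ->. Qed.

Lemma den_if_field (h : store R) r f s1 s2 : ireg h rZ = 0%N ->
  let h1 := den (CField rF f r) h in
  den (CIfI rZ rF s1 s2) h1 =
  if (0 < inp f (ireg h r))%N then den s1 h1 else den s2 h1.
Proof.
move=> hz h1.
rewrite -[LHS]/(if (ireg h rZ < inp f (ireg h r))%N then den s1 h1 else den s2 h1).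
by rewrite hz.
Qed.

End Blocks.

Lemma big_nat_recr_cond (R : realType) (Q : pred nat) (F : nat -> R) u :
  \sum_(0 <= j < u.+1 | Q j) F j =
  \sum_(0 <= j < u | Q j) F j + (if Q u then F u else 0).
Proof. by rewrite !(big_mkcond Q) big_nat_recr. Qed.

(** * Invariants of the two passes *)

Section Phases.
Variables (R : realType) (d : nat) (oracle : nat -> R -> R) (n : nat)
          (inp : nat -> nat -> nat) (x : 'I_d -> R) (g : 'I_d -> R -> R).
Variables (leaf : pred nat) (feat left right : nat -> nat) (val : nat -> R)
          (path : nat -> seq (nat * constr R d)).
Notation den := (den oracle n inp).

Definition conds j : seq (constr R d) := [seq it.2 | it <- path j].

Hypothesis inp_leaf : forall j, (j < n)%N -> inp 0 j = leaf j.
Hypothesis inp_feat : forall j, (j < n)%N -> inp 1 j = feat j.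
Hypothesis inp_left : forall j, (j < n)%N -> inp 2 j = left j.
Hypothesis inp_right : forall j, (j < n)%N -> inp 3 j = right j.
Hypothesis gE : forall (q : 'I_d) t,
  g q t = if (0 < inp 5 q)%N then oracle q (t - x q) else (x q < t)%R%:R.

Definition node_at (j : nat) (q : 'I_d) (t : R) : Prop :=
  [/\ ~~ leaf j, feat j = q & val j = t].

(** With [parent], this is what the passes use of the tree structure: children come after their
    parent in the numbering, and their paths extend its path by one test. *)
Hypothesis children : forall j, (j < n)%N -> ~~ leaf j -> exists q t,
  [/\ node_at j q t, (j < left j < n)%N, (j < right j < n)%N,
      path (left j) = (j, (q, t, true)) :: path j
    & path (right j) = (j, (q, t, false)) :: path j].

Hypothesis parent : forall j, (j < n)%N -> path j = [::] \/
  exists w (c : constr R d), [/\ path j = (w, c) :: path w, (w < j)%N, ~~ leaf w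
    & j = if c.2 then left w else right w].

(** Whether the values of j are in place once the nodes below u are processed: those of a root are
    initial, the others are written with the parent. *)
Definition known (u j : nat) : bool := if path j is (w, _) :: _ then (w < u)%N else true.

Lemma known_refl j : (j < n)%N -> known j j.
Proof. by move=> /parent[|[w [c []]]]; rewrite /known => ->. Qed.

Lemma known_all j : (j < n)%N -> known n j.
Proof. by move=> jn; have [|[w [c []]]] := parent jn; rewrite /known => -> //; lia. Qed.

Lemma known_leaf u j : (j < n)%N -> leaf u -> known u.+1 j = known u j.
Proof.
move=> jn lu; rewrite /known; have [->//|[w [c [-> _ lw _]]]] := parent jn.
rewrite ltnS leq_eqVlt; case: (w =P u) => // E.
by rewrite E lu in lw.
Qed.

(** Processing u adds only its children, which were not known before, so nothing known is
    overwritten. *)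
Lemma known_step u j : (u < n)%N -> (j < n)%N -> ~~ leaf u ->
  known u.+1 j -> [\/ j = left u, j = right u |
    [/\ known u j, j != left u & j != right u]].
Proof.
move=> un jn lu.
have [q [t [_ _ _ pl pr]]] := children un lu.
have nl : ~~ known u (left u) by rewrite /known pl ltnn.
have nr : ~~ known u (right u) by rewrite /known pr ltnn.
move=> H; have [ku|ku] := boolP (known u j).
  constructor 3; split=> //; first by apply: contraNneq nl => <-.
  by apply: contraNneq nr => <-.
move: H ku; rewrite /known; have [->//|[w [c [-> _ lw E]]]] := parent jn.
move=> H1 H2; have Ew : w = u by lia.
by rewrite Ew in E; case: c.2 E => ->; [constructor 1|constructor 2].
Qed.

(** Their paths differ in the outcome of the test at u. *)
Lemma left_neq_right u : (u < n)%N -> ~~ leaf u -> (left u == right u) = false.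
Proof.
move=> un lu; have [q [t [_ _ _ pl pr]]] := children un lu.
by apply/negP => /eqP E; move: pl; rewrite E pr.
Qed.

Lemma lenE p i : len g p i = cur_len (lower g p i) (upper g p i).
Proof. by []. Qed.

Lemma len_left p (q : 'I_d) t :
  len g ((q, t, true) :: p) q = left_len (lower g p q) (upper g p q) (g q t).
Proof. by rewrite /len /= eqxx. Qed.

Lemma len_right p (q : 'I_d) t :
  len g ((q, t, false) :: p) q = right_len (lower g p q) (upper g p q) (g q t).
Proof. by rewrite /len /= eqxx. Qed.

Definition base_inv (h : store R) : Prop :=
  [/\ rreg h fOne = 1, rreg h fZero = 0, ireg h rZ = 0%N,
      forall j, arr h 0 j = val j & forall q : 'I_d, arr h 1 q = x q].

Definition cdfs_ok u (h : store R) : Prop :=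
  forall w q t, (w < u)%N -> node_at w q t -> arr h 4 w = g q t.

Definition tables_ok u (h : store R) : Prop :=
  forall j, (j < n)%N -> known u j ->
  [/\ forall w, (w < n)%N -> arr h 2 (w * n + j)%N = lower g (conds j) (feat w),
      forall w, (w < n)%N -> arr h 3 (w * n + j)%N = upper g (conds j) (feat w)
    & arr h 5 j = 1 - cprob g [::] (conds j)].

Definition indicators_ok u (h : store R) : Prop :=
  forall j, (j < n)%N -> known u j -> arr h 6 j = 1 - (sat x (conds j))%:R.

Definition value_sum u : R := \sum_(0 <= j < u | leaf j) val j * (sat x (conds j))%:R.

Definition inv1 u (h : store R) : Prop :=
  [/\ base_inv h, ireg h rUU = (u * n + u)%N,
      cdfs_ok u h, tables_ok u h & indicators_ok u h /\ rreg h fF = value_sum u].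

Lemma base_inv_frame h s :
  fOne \notin rregs s -> fZero \notin rregs s -> rZ \notin iregs s ->
  0%N \notin chans s -> 1%N \notin chans s -> base_inv h -> base_inv (den s h).
Proof.
move=> H1 H2 H3 H4 H5 [E1 E2 E3 E4 E5].
by split=> [|||j|q]; rewrite ?den_rreg ?den_ireg ?den_arr.
Qed.

(** A leaf adds its value to f(x) if [x] reaches it and leaves the arrays unchanged; an inner node
    derives the values of its children from its own, in place by [known_refl]. *)
Lemma phase1_step u h : (u < n)%N -> ireg h rU = u -> inv1 u h ->
  inv1 u.+1 (set_ireg (den phase1_body h) rU u.+1).
Proof.
move=> un hU [hB hUU hC hT [hI hF]].
rewrite /phase1_body 3!den_seqs_cons den_nil.
have [h1 h0 hz hval hx] := hB.
rewrite (den_if_field _ _ _ _ _ _ _ hz) hU inp_leaf //.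
set s1 := den (CField rF 0 rU) h.
have s1B : base_inv s1 by exact: base_inv_frame.
have s1U : ireg s1 rU = u by rewrite den_ireg.
have s1UU : ireg s1 rUU = (u * n + u)%N by rewrite den_ireg.
have s1M : arr s1 = arr h by [].
have s1F : rreg s1 = rreg h by [].
have [s11 s10 s1z _ _] := s1B.
rewrite lt0b /= -/s1; clearbody s1; case: ifPn => lu.
- have FV := @den_leaf_value _ oracle n inp s1 s11.
  set s2 := den leaf_value s1 in FV *.
  have s2M : arr s2 = arr h by rewrite -s1M; apply/funext => c; rewrite den_arr.
  have s2UU : ireg s2 rUU = (u * n + u)%N by rewrite den_ireg.
  have s3UU := @den_next_diag _ oracle n inp s2 u s2UU.
  set s3 := den next_diag s2 in s3UU *.
  have s3M : arr s3 = arr h by rewrite -s2M; apply/funext => c; rewrite den_arr.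
  have s3B : base_inv s3 by do 2 (apply: base_inv_frame => //).
  split=> //.
  + move=> w q t Hw Hn; rewrite arr_set s3M; apply: hC => //.
    have [nw _ _] := Hn; move: Hw; rewrite ltnS leq_eqVlt.
    by case: eqP => // E; rewrite E lu in nw.
  + move=> j jn; rewrite known_leaf // => kj; rewrite arr_set s3M; exact: hT.
  split.
    by move=> j jn; rewrite known_leaf // => kj; rewrite arr_set s3M; exact: hI.
  rewrite rreg_set den_rreg // FV s1F s1M s1U hF hval hI ?known_refl //.
  by rewrite /value_sum big_nat_recr_cond lu subKr.
- have [q [t [[_ fq vt] lta ltb pl pr]]] := children un lu.
  have := @den_inner_node _ oracle n inp s1 u (left u) (right u) q t s11 s10 s1z s1U s1UU.
  rewrite inp_feat // inp_left // inp_right // s1M hval hx /= -gE.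
  move=> /(_ fq erefl erefl vt lta ltb) [M4 M5 M6 M23].
  set s2 := den inner_node s1 in M4 M5 M6 M23 *.
  have s2UU : ireg s2 rUU = (u * n + u)%N by rewrite den_ireg.
  have s3UU := @den_next_diag _ oracle n inp s2 u s2UU.
  set s3 := den next_diag s2 in s3UU *.
  have s3M : arr s3 = arr s2 by apply/funext => c; rewrite den_arr.
  have s3B : base_inv s3 by do 2 (apply: base_inv_frame => //).
  have [T2 T3 T5] := hT u un (known_refl un).
  have T6 := hI u un (known_refl un).
  have clr := left_neq_right un lu.
  have cl : conds (left u) = (q, t, true) :: conds u by rewrite /conds pl.
  have cr : conds (right u) = (q, t, false) :: conds u by rewrite /conds pr.
  split=> //.
  + move=> w q' t' Hw [nw fw vw]; rewrite arr_set s3M M4.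
    case: eqP => [E|E]; last by apply: hC => //; lia.
    have -> : q' = q by apply: val_inj; rewrite /= -fw E.
    by rewrite -vw E vt.
  + move=> j jn /(known_step un jn lu)[->|->|[kj jl jr]]; rewrite arr_set s3M.
    * split.
      - move=> w wn; have [-> _] := M23 w (left u) wn (proj2 (andP lta)).
        by rewrite clr eqxx T2 // cl /= andbF.
      - move=> w wn; have [_ ->] := M23 w (left u) wn (proj2 (andP lta)).
        by rewrite clr eqxx inp_feat // T3 // cl /= andbT eq_sym.
      rewrite M5 clr eqxx T2 // T3 // T5 cl /= cats0 len_left lenE fq.
      by rewrite subKr.
    * split.
      - move=> w wn; have [-> _] := M23 w (right u) wn (proj2 (andP ltb)).
        by rewrite eqxx inp_feat // T2 // cr /= andbT eq_sym.
      - move=> w wn; have [_ ->] := M23 w (right u) wn (proj2 (andP ltb)).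
        by rewrite eqxx T3 // cr /= andbF.
      rewrite M5 eqxx T2 // T3 // T5 cr /= cats0 len_right lenE fq.
      by rewrite subKr.
    * have [U2 U3 U5] := hT j jn kj; split.
      - by move=> w wn; have [-> _] := M23 w j wn jn; rewrite (negbTE jl) (negbTE jr) U2.
      - by move=> w wn; have [_ ->] := M23 w j wn jn; rewrite (negbTE jl) (negbTE jr) U3.
      by rewrite M5 (negbTE jl) (negbTE jr).
  split.
    move=> j jn /(known_step un jn lu)[->|->|[kj jl jr]]; rewrite arr_set s3M M6.
    * rewrite clr eqxx T6 subKr cl /= /holds /= eqb_id mulrC -natrM mulnb.
      by [].
    * rewrite eqxx T6 subKr cr /= /holds /= eqbF_neg.
      by case: (x q < t); case: (sat x (conds u)); rewrite /=; ring.
    * by rewrite (negbTE jl) (negbTE jr) hI.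
  rewrite rreg_set !den_rreg // s1F hF.
  by rewrite /value_sum big_nat_recr_cond (negbTE lu) addr0.
Qed.

Definition cond_ok u v (h : store R) : Prop :=
  forall j, (j < n)%N -> known v j -> arr h 6 j = 1 - cprob g (conds u) (conds j).

Definition cond_sum u v : R :=
  \sum_(0 <= j < v | leaf j) val j * cprob g (conds u) (conds j).

(** [h0] is the store from which the inner loop for u starts; [fF] and [fAcc] keep their values from
    it. *)
Definition inv2 (h0 : store R) u v (h : store R) : Prop :=
  [/\ base_inv h, ireg h rUU = (v * n + v)%N /\ ireg h rVN = (v * n)%N,
      cdfs_ok n h, tables_ok n h & [/\ cond_ok u v h, ireg h rU = u,
      rreg h fF = rreg h0 fF, rreg h fAcc = rreg h0 fAcc
      & rreg h fSum = cond_sum u v - rreg h0 fF - rreg h0 fF]].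

Lemma cdfs_ok_frame k h s : 4%N \notin chans s -> cdfs_ok k h -> cdfs_ok k (den s h).
Proof. by move=> Hs H w q t; rewrite den_arr //; exact: H. Qed.

Lemma tables_ok_frame k h s : 2%N \notin chans s -> 3%N \notin chans s ->
  5%N \notin chans s -> tables_ok k h -> tables_ok k (den s h).
Proof. by move=> H2 H3 H5 H j; rewrite !den_arr //; exact: H. Qed.

Lemma den_advance h v : ireg h rUU = (v * n + v)%N -> ireg h rVN = (v * n)%N ->
  let h' := den next_diag (den (CAddN rVN rVN) h) in
  [/\ ireg h' rUU = (v.+1 * n + v.+1)%N, ireg h' rVN = (v.+1 * n)%N,
      rreg h' = rreg h & arr h' = arr h].
Proof. by case: h => i r m; run => -> ->; rewrite mulSn; split=> //; lia. Qed.

(** By [lower_cat] and [upper_cat], the maxima of two tabulated entries are the bounds of the joint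
    path. *)
Lemma den_pair_inner_joint u v q t h : (u < n)%N -> (v < n)%N ->
  ireg h rU = u -> ireg h rV = v ->
  ireg h rUU = (v * n + v)%N -> ireg h rVN = (v * n)%N ->
  base_inv h -> cdfs_ok n h -> tables_ok n h -> node_at v q t ->
  let p := conds v ++ conds u in
  forall k, arr (den pair_inner h) 6 k =
    if k == right v then 1 - (1 - arr h 6 v) * len g ((q, t, false) :: p) q / len g p q
    else if k == left v then 1 - (1 - arr h 6 v) * len g ((q, t, true) :: p) q / len g p q
    else arr h 6 k.
Proof.
move=> un vn hU hV hUU hVN [h1 h0 _ _ _] hC hT nv p k; have [_ fq _] := nv.
have := @den_pair_inner _ oracle n inp h v (left v) (right v) h1 h0 hV
    (inp_left vn) (inp_right vn).
have [V2 V3 _] := hT v vn (known_all vn).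
have [U2 U3 _] := hT u un (known_all un).
move: (den pair_inner h) => s2.
rewrite hUU hVN hU (hC _ _ _ vn nv) (V2 _ vn) (V3 _ vn) (U2 _ vn) (U3 _ vn).
by rewrite -lower_cat -upper_cat fq len_left len_right lenE => ->.
Qed.

Lemma inv2_advance h0 u v h :
  base_inv h -> ireg h rUU = (v * n + v)%N -> ireg h rVN = (v * n)%N ->
  cdfs_ok n h -> tables_ok n h -> cond_ok u v.+1 h -> ireg h rU = u ->
  rreg h fF = rreg h0 fF -> rreg h fAcc = rreg h0 fAcc ->
  rreg h fSum = cond_sum u v.+1 - rreg h0 fF - rreg h0 fF ->
  inv2 h0 u v.+1 (set_ireg (den next_diag (den (CAddN rVN rVN) h)) rV v.+1).
Proof.
move=> hB hUU hVN hC hT hO hU hF hA hS.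
have [UU VN] := den_advance hUU hVN.
have B1 : base_inv (den next_diag (den (CAddN rVN rVN) h)).
  by do 2 (apply: base_inv_frame => //).
have U1 : ireg (den next_diag (den (CAddN rVN rVN) h)) rU = u.
  by rewrite !den_ireg.
move: (den next_diag _) UU VN B1 U1 => s UU VN B1 U1 RE ME.
split=> //.
- by move=> w q t; rewrite arr_set ME; exact: hC.
- by move=> j; rewrite arr_set ME; exact: hT.
by split=> //; rewrite ?rreg_set ?RE // /cond_ok arr_set ME.
Qed.

(** A leaf v adds its value times P(v | u) to the sum; an inner v passes its conditional probability
    on to its children. *)
Lemma pair_step h0 u v h : (u < n)%N -> (v < n)%N -> ireg h rV = v ->
  inv2 h0 u v h -> inv2 h0 u v.+1 (set_ireg (den pair_body h) rV v.+1).
Proof.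
move=> un vn hV [hB [hUU hVN] hC hT [hO hU hF hA hS]].
rewrite /pair_body 4!den_seqs_cons den_nil.
have [_ _ hz hval hx] := hB.
rewrite (den_if_field _ _ _ _ _ _ _ hz) hV inp_leaf //.
set s1 := den (CField rF 0 rV) h.
have s1B : base_inv s1 by exact: base_inv_frame.
have s1U : ireg s1 rU = u by rewrite den_ireg.
have s1V : ireg s1 rV = v by rewrite den_ireg.
have s1UU : ireg s1 rUU = (v * n + v)%N by rewrite den_ireg.
have s1VN : ireg s1 rVN = (v * n)%N by rewrite den_ireg.
have s1M : arr s1 = arr h by [].
have s1F : rreg s1 = rreg h by [].
have s1C : cdfs_ok n s1 by exact: cdfs_ok_frame.
have s1T : tables_ok n s1 by exact: tables_ok_frame.
have [s11 s10 _ _ _] := s1B.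
rewrite lt0b /= -/s1; clearbody s1; case: ifPn => lv.
- apply: inv2_advance.
  + exact: base_inv_frame.
  + by rewrite den_ireg.
  + by rewrite den_ireg.
  + exact: cdfs_ok_frame.
  + exact: tables_ok_frame.
  + by move=> j jn; rewrite known_leaf // den_arr // s1M; exact: hO.
  + by rewrite den_ireg.
  + by rewrite den_rreg // s1F.
  + by rewrite den_rreg // s1F.
  rewrite den_pair_leaf // s1F s1M s1V hS hval hO ?known_refl //.
  by rewrite /cond_sum big_nat_recr_cond lv subKr; ring.
- have [q [t [nv lta ltb pl pr]]] := children vn lv.
  apply: inv2_advance.
  + exact: base_inv_frame.
  + by rewrite den_ireg.
  + by rewrite den_ireg.
  + exact: cdfs_ok_frame.
  + exact: tables_ok_frame.
  + have s16 : arr s1 6 v = 1 - cprob g (conds u) (conds v).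
      by rewrite s1M hO ?known_refl.
    have cl : conds (left v) = (q, t, true) :: conds v by rewrite /conds pl.
    have cr : conds (right v) = (q, t, false) :: conds v by rewrite /conds pr.
    move=> j jn.
    rewrite (den_pair_inner_joint un vn s1U s1V s1UU s1VN s1B s1C s1T nv) s16 subKr.
    move=> /(known_step vn jn lv)[->|->|[kj jl jr]].
    * by rewrite (left_neq_right vn lv) eqxx cl.
    * by rewrite eqxx cr.
    * by rewrite (negbTE jl) (negbTE jr) s1M hO.
  + by rewrite den_ireg.
  + by rewrite den_rreg // s1F.
  + by rewrite den_rreg // s1F.
  by rewrite den_rreg // s1F hS /cond_sum big_nat_recr_cond (negbTE lv) addr0.
Qed.

Definition pair_sum u : R :=
  \sum_(0 <= j < u | leaf j) val j * cprob g [::] (conds j) *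
     (cond_sum j n - value_sum n - value_sum n).

(** Array 6 is reused for every leaf u. Only the entries of roots must survive from one leaf to the
    next, as all others are rewritten from their parents before being read. *)
Definition inv3 u (h : store R) : Prop :=
  [/\ base_inv h, cdfs_ok n h, tables_ok n h
    & [/\ forall j, (j < n)%N -> path j = [::] -> arr h 6 j = 0,
      rreg h fF = value_sum n & rreg h fAcc = pair_sum u]].

Lemma phase2_step u h : (u < n)%N -> ireg h rU = u -> inv3 u h ->
  inv3 u.+1 (set_ireg (den phase2_body h) rU u.+1).
Proof.
move=> un hU [hB hC hT [hR hF hA]].
rewrite /phase2_body 2!den_seqs_cons den_nil.
have [_ _ hz _ _] := hB.
rewrite (den_if_field _ _ _ _ _ _ _ hz) hU inp_leaf //.
set s1 := den (CField rF 0 rU) h.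
have s1B : base_inv s1 by exact: base_inv_frame.
have s1U : ireg s1 rU = u by rewrite den_ireg.
have s1M : arr s1 = arr h by [].
have s1F : rreg s1 = rreg h by [].
have s1C : cdfs_ok n s1 by exact: cdfs_ok_frame.
have s1T : tables_ok n s1 by exact: tables_ok_frame.
have [s11 s10 _ _ _] := s1B.
rewrite lt0b /= -/s1; clearbody s1; case: ifPn => lu.
- rewrite /phase2_leaf 3!den_seqs_cons den_nil.
  have [S2 VN2 UU2] := @den_phase2_init _ oracle n inp s1 s10.
  set s2 := den phase2_init s1 in S2 VN2 UU2 *.
  have s2M : arr s2 = arr h by rewrite -s1M; apply/funext => c; rewrite den_arr.
  (* Before the first round only roots are known; their conditional probability is 1, so the
     surviving zeros are correct. *)
  have H2 : inv2 s1 u 0 (set_ireg s2 rV 0).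
    have s2B : base_inv s2 by exact: base_inv_frame.
    have s2C : cdfs_ok n s2 by exact: cdfs_ok_frame.
    have s2T : tables_ok n s2 by exact: tables_ok_frame.
    split=> //.
    split.
    + move=> j jn kj; rewrite arr_set s2M.
      have pj : path j = [::].
        by move: kj; rewrite /known; case: (path j) => // -[w c] p.
      by rewrite hR // /conds pj /= subrr.
    + by rewrite ireg_set_neq // den_ireg.
    + by rewrite rreg_set den_rreg.
    + by rewrite rreg_set den_rreg.
    by rewrite rreg_set S2 /cond_sum big_geq // sub0r.
  have H3 : inv2 s1 u n (den (CFor rV pair_body) s2).
    apply: (den_for (Inv := inv2 s1 u)) => // k h' Hk hk Hi.
    exact: pair_step.
  set s3 := den (CFor rV pair_body) s2 in H3 *.
  have [s3B _ s3C s3T [s3O s3U s3F s3A s3S]] := H3.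
  have [s31 _ _ s3val _] := s3B.
  have A4 := @den_phase2_add _ oracle n inp s3 s31.
  set s4 := den phase2_add s3 in A4 *.
  have s4B : base_inv s4 by exact: base_inv_frame.
  have s4C : cdfs_ok n s4 by exact: cdfs_ok_frame.
  have s4T : tables_ok n s4 by exact: tables_ok_frame.
  split=> //.
  split.
  + move=> j jn pj; rewrite arr_set den_arr // s3O ?known_all //.
    by rewrite /conds pj /= subrr.
  + by rewrite rreg_set den_rreg // s3F s1F.
  have [_ _ T5] := s3T u un (known_all un).
  rewrite rreg_set A4 s3A s3S s3U s3val T5 s1F hA hF subKr.
  by rewrite /pair_sum big_nat_recr_cond lu.
- rewrite -[den CSkip s1]/s1.
  split=> //; split.
  + by move=> j jn pj; rewrite arr_set s1M hR.
  + by rewrite rreg_set s1F.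
  by rewrite rreg_set s1F hA /pair_sum big_nat_recr_cond (negbTE lu) addr0.
Qed.

Lemma den_pg2_cmd h : rreg h fZero = 0 -> ireg h rZ = 0%N -> ireg h rUU = 0%N ->
  rreg h fF = 0 -> rreg h fAcc = 0 ->
  (forall j, arr h 0 j = val j) -> (forall q : 'I_d, arr h 1 q = x q) ->
  (forall c j, (1 < c)%N -> arr h c j = 0) ->
  arr (den pg2_cmd h) 0 0%N = pair_sum n + value_sum n * value_sum n.
Proof.
move=> h0 hz hUU hF hA hval hx harr.
rewrite /pg2_cmd 4!den_seqs_cons den_nil.
set s1 := den (CConst fOne 1) h.
have s1M : arr s1 = arr h by [].
have s1O : rreg s1 fOne = 1 by rewrite -[LHS]/(ratr 1) rmorph1.
(* The initial zeros are the correct entries of roots: the empty path has both bounds 0, and its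
   probability and indicator are 1, stored as complements. *)
have H1 : inv1 0 (set_ireg s1 rU 0).
  split=> //.
  - move=> j jn kj; have pj : path j = [::].
      by move: kj; rewrite /known; case: (path j) => // -[w c] p.
    by rewrite /conds pj arr_set s1M; split=> [w _|w _|]; rewrite harr //= subrr.
  split.
    move=> j jn kj; have pj : path j = [::].
      by move: kj; rewrite /known; case: (path j) => // -[w c] p.
    by rewrite /conds pj arr_set s1M harr //= subrr.
  by rewrite rreg_set den_rreg // hF /value_sum big_geq.
have H2 : inv1 n (den (CFor rU phase1_body) s1).
  apply: (den_for (Inv := inv1)) => // k h' Hk hk Hi; exact: phase1_step.
have A2 : rreg (den (CFor rU phase1_body) s1) fAcc = 0 by rewrite !den_rreg.
set s2 := den (CFor rU phase1_body) s1 in H2 A2 *.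
have [s2B _ s2C s2T [s2I s2F]] := H2.
have H3 : inv3 0 (set_ireg s2 rU 0).
  split=> //; split=> //.
    move=> j jn pj; rewrite arr_set s2I ?known_all //.
    by rewrite /conds pj /= subrr.
  by rewrite rreg_set A2 /pair_sum big_geq.
have H4 : inv3 n (den (CFor rU phase2_body) s2).
  apply: (den_for (Inv := inv3)) => // k h' Hk hk Hi; exact: phase2_step.
set s3 := den (CFor rU phase2_body) s2 in H4 *.
have [[_ _ s3z _ _] _ _ [_ s3F s3A]] := H4.
by rewrite den_finish // s3F s3A.
Qed.

End Phases.

(** * The encoded ensemble *)

Section Encoding.
Variables (R : realType) (d : nat).
Implicit Types (T : tree d R) (E : seq (tree d R)).

(** Recursion on the tree replaces lookup in the flattened list, so facts about nodes follow by
    induction on the tree. *)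
Fixpoint tree_node (base : nat) T (j : nat) : enode R :=
  match T with
  | Leaf y => ENode true 0%N y 0%N 0%N
  | Node q t a b =>
      let mid := (base.+1 + tree_size a)%N in
      if j == base then ENode false q t base.+1 mid
      else if (j < mid)%N then tree_node base.+1 a j else tree_node mid b j
  end.

(* The tests on the way from node [j] up to the root, which extends [pre]. *)
Fixpoint tree_path (base : nat) (pre : seq (nat * constr R d)) T (j : nat) :
    seq (nat * constr R d) :=
  match T with
  | Leaf _ => pre
  | Node q t a b =>
      let mid := (base.+1 + tree_size a)%N in
      if j == base then pre
      else if (j < mid)%N then tree_path base.+1 ((base, (q, t, true)) :: pre) a j
      else tree_path mid ((base, (q, t, false)) :: pre) b j
  end.

Fixpoint ens_node (base : nat) E (j : nat) : enode R :=
  if E is T :: E' then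
    if (j < base + tree_size T)%N then tree_node base T j
    else ens_node (base + tree_size T) E' j
  else dflt_node R.

Fixpoint ens_path (base : nat) E (j : nat) : seq (nat * constr R d) :=
  if E is T :: E' then
    if (j < base + tree_size T)%N then tree_path base [::] T j
    else ens_path (base + tree_size T) E' j
  else [::].

Lemma tree_size_gt0 T : (0 < tree_size T)%N.
Proof. by case: T. Qed.

Lemma size_enc_tree base T : size (enc_tree base T) = tree_size T.
Proof. by elim: T base => //= q t a IHa b IHb base; rewrite size_cat IHa IHb. Qed.

Lemma nth_enc_tree base T j : (j < tree_size T)%N ->
  nth (dflt_node R) (enc_tree base T) j = tree_node base T (base + j).
Proof.
elim: T base j => [y|q t a IHa b IHb] base [|j] //= Hj; first by rewrite addn0 eqxx.
rewrite ifF; last by lia.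
rewrite nth_cat size_enc_tree; case: ltnP => Hja.
  by rewrite IHa // ifT; [congr tree_node; lia | lia].
by rewrite IHb; [rewrite ifF; [congr tree_node; lia | lia] | lia].
Qed.

Lemma ens_size_cons T E : ens_size (T :: E) = (tree_size T + ens_size E)%N.
Proof. by rewrite /ens_size big_cons. Qed.

Lemma size_enc_ens base E : size (enc_ens base E).1 = ens_size E.
Proof.
elim: E base => [|T E IH] base; first by rewrite /ens_size big_nil.
rewrite ens_size_cons -(IH (base + tree_size T)%N) /=.
by case: (enc_ens _ E) => ns rs; rewrite size_cat size_enc_tree.
Qed.

Lemma nth_enc_ens base E j : (j < ens_size E)%N ->
  nth (dflt_node R) (enc_ens base E).1 j = ens_node base E (base + j).
Proof.
elim: E base j => [|T E IH] base j; first by rewrite /ens_size big_nil.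
rewrite ens_size_cons => Hj /=.
have := IH (base + tree_size T)%N; case: (enc_ens _ E) => ns rs /= {}IH.
rewrite nth_cat size_enc_tree ltn_add2l; case: ltnP => HT.
  exact: nth_enc_tree.
by rewrite IH; [congr ens_node; lia | lia].
Qed.

Lemma tree_path_root base pre T : tree_path base pre T base = pre.
Proof. by case: T => //= *; rewrite eqxx. Qed.

(** In preorder the left child comes right after its parent and the right child after the whole left
    subtree; the induction enters the subtree whose range contains [j]. *)
Lemma tree_children base pre T j : (base <= j < base + tree_size T)%N ->
  let nd := tree_node base T in let path := tree_path base pre T in
  ~~ en_leaf (nd j) -> exists (q : 'I_d) t,
  [/\ en_feat (nd j) = q /\ en_val (nd j) = t,
      (j < en_left (nd j) < base + tree_size T)%N,
      (j < en_right (nd j) < base + tree_size T)%N,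
      path (en_left (nd j)) = (j, (q, t, true)) :: path j
    & path (en_right (nd j)) = (j, (q, t, false)) :: path j].
Proof.
elim: T base pre => [y|q t a IHa b IHb] base pre //= Hj.
have [Ej|nj] := eqVneq j base.
  subst j => _; exists q, t; have := tree_size_gt0 b; have := tree_size_gt0 a.
  move=> a0 b0; split=> //=; try lia.
    rewrite ifF; last by lia.
    by rewrite ifT ?tree_path_root //; lia.
  rewrite ifF; last by lia.
  by rewrite ltnn tree_path_root.
case: ltnP => Hm lj.
  have [|q' [t' [H1 H2 H3 H4 H5]]] := IHa base.+1 ((base, (q, t, true)) :: pre) _ lj; first by lia.
  exists q', t'; split=> //; try lia.
    by rewrite ifF; [rewrite ifT // ; lia | lia].
  by rewrite ifF; [rewrite ifT // ; lia | lia].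
have [|q' [t' [H1 H2 H3 H4 H5]]] := IHb (base.+1 + tree_size a)%N
  ((base, (q, t, false)) :: pre) _ lj; first by lia.
exists q', t'; split=> //; try lia.
  by rewrite ifF; [rewrite ifF // ; lia | lia].
by rewrite ifF; [rewrite ifF // ; lia | lia].
Qed.

Lemma tree_parent base pre T j : (base <= j < base + tree_size T)%N ->
  let nd := tree_node base T in let path := tree_path base pre T in
  j = base \/ exists w (c : constr R d),
  [/\ path j = (w, c) :: path w, (base <= w < j)%N, ~~ en_leaf (nd w)
    & j = if c.2 then en_left (nd w) else en_right (nd w)].
Proof.
elim: T base pre => [y|q t a IHa b IHb] base pre /= Hj; first by left; lia.
have [Ej|nj] := eqVneq j base; [by left | right].
case: ltnP => Hm.
  have [|->|[w [c [H1 H2 H3 H4]]]] := IHa base.+1 ((base, (q, t, true)) :: pre); first by lia.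
    by exists base, (q, t, true); rewrite !eqxx tree_path_root; split=> //; lia.
  have Hw : (w == base) = false by lia.
  have Hwm : (w < base.+1 + tree_size a)%N by lia.
  by exists w, c; rewrite Hw Hwm; split=> //; lia.
have [|->|[w [c [H1 H2 H3 H4]]]] := IHb (base.+1 + tree_size a)%N
  ((base, (q, t, false)) :: pre); first by lia.
  by exists base, (q, t, false); rewrite !eqxx tree_path_root; split=> //; lia.
have Hw : (w == base) = false by lia.
have Hwm : (w < base.+1 + tree_size a)%N = false by lia.
by exists w, c; rewrite Hw Hwm; split=> //; lia.
Qed.

(** Only the leaf reached by [z] has all its tests satisfied. The factor for [pre] lets the
    induction pass to subtrees. *)
Lemma tree_evalE base pre T z :
  \sum_(base <= j < base + tree_size T | en_leaf (tree_node base T j))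
     en_val (tree_node base T j) *
     (sat z [seq it.2 | it <- tree_path base pre T j])%:R
  = (sat z [seq it.2 | it <- pre])%:R * tree_eval T z.
Proof.
elim: T base pre => [y|q t a IHa b IHb] base pre.
  by rewrite addn1 big_mkcond big_nat1 /= mulrC.
rewrite big_mkcond /= big_ltn /=; last by lia.
rewrite eqxx /= add0r (@big_cat_nat _ _ _ (base.+1 + tree_size a)%N) /=; try lia.
rewrite addnS -addSn addnA.
transitivity (
    (sat z [seq it.2 | it <- (base, (q, t, true)) :: pre])%:R * tree_eval a z +
    (sat z [seq it.2 | it <- (base, (q, t, false)) :: pre])%:R * tree_eval b z).
  congr (_ + _).
    rewrite -(IHa base.+1) [RHS]big_mkcond; apply: eq_big_nat => j Hj.
    have -> : (j == base) = false by lia.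
    by have -> : (j < base.+1 + tree_size a)%N by lia.
  rewrite -(IHb (base.+1 + tree_size a)%N) [RHS]big_mkcond; apply: eq_big_nat => j Hj.
  have -> : (j == base) = false by lia.
  by have -> : (j < base.+1 + tree_size a)%N = false by lia.
(* Exactly one outcome of the root's test holds at [z], and it selects the subtree that [tree_eval]
   enters. *)
by rewrite /= /holds /=; case: (z q < t) => /=; ring.
Qed.

Lemma ens_children base E j : (base <= j < base + ens_size E)%N ->
  let nd := ens_node base E in let path := ens_path base E in
  ~~ en_leaf (nd j) -> exists (q : 'I_d) t,
  [/\ en_feat (nd j) = q /\ en_val (nd j) = t,
      (j < en_left (nd j) < base + ens_size E)%N,
      (j < en_right (nd j) < base + ens_size E)%N,
      path (en_left (nd j)) = (j, (q, t, true)) :: path j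
    & path (en_right (nd j)) = (j, (q, t, false)) :: path j].
Proof.
elim: E base => [|T E IH] base /=; first by rewrite /ens_size big_nil; lia.
rewrite ens_size_cons => Hj; case: ltnP => Hm lj.
  have [|q' [t' [H1 H2 H3 H4 H5]]] := @tree_children base [::] T j _ lj; first by lia.
  exists q', t'; split=> //; try lia.
    by rewrite ifT //; lia.
  by rewrite ifT //; lia.
have [|q' [t' [H1 H2 H3 H4 H5]]] := IH (base + tree_size T)%N _ lj; first by lia.
exists q', t'; split=> //; try lia.
  by rewrite ifF //; lia.
by rewrite ifF //; lia.
Qed.

Lemma ens_parent base E j : (base <= j < base + ens_size E)%N ->
  let nd := ens_node base E in let path := ens_path base E in
  path j = [::] \/ exists w (c : constr R d),
  [/\ path j = (w, c) :: path w, (base <= w < j)%N, ~~ en_leaf (nd w)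
    & j = if c.2 then en_left (nd w) else en_right (nd w)].
Proof.
elim: E base => [|T E IH] base /=; first by left.
rewrite ens_size_cons => Hj; case: ltnP => Hm.
  have [|->|[w [c [H1 H2 H3 H4]]]] := @tree_parent base [::] T j; first by lia.
    by left; rewrite tree_path_root.
  have Hwm : (w < base + tree_size T)%N by lia.
  by right; exists w, c; rewrite Hwm.
have [|->|[w [c [H1 H2 H3 H4]]]] := IH (base + tree_size T)%N; [lia|by left|right].
have Hwm : (w < base + tree_size T)%N = false by lia.
by exists w, c; rewrite Hwm; split=> //; lia.
Qed.

Lemma ens_evalE base E z :
  \sum_(base <= j < base + ens_size E | en_leaf (ens_node base E j))
     en_val (ens_node base E j) * (sat z [seq it.2 | it <- ens_path base E j])%:R
  = ens_eval E z.
Proof.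
elim: E base => [|T E IH] base.
  by rewrite /ens_size /ens_eval !big_nil addn0 big_geq.
rewrite ens_size_cons /ens_eval big_cons -/(ens_eval E z) big_mkcond.
rewrite (@big_cat_nat _ _ _ (base + tree_size T)%N) /=; try lia.
congr (_ + _).
  have := tree_evalE base [::] T z; rewrite /= mul1r => <-.
  by rewrite [RHS]big_mkcond; apply: eq_big_nat => j /andP[_ ->].
rewrite addnA -(IH (base + tree_size T)%N) [RHS]big_mkcond.
apply: eq_big_nat => j Hj.
by have -> : (j < base + tree_size T)%N = false by lia.
Qed.

Definition enc_node E (j : nat) : enode R := nth (dflt_node R) (enc_ens 0 E).1 j.

Lemma enc_nodeE E j : (j < ens_size E)%N -> enc_node E j = ens_node 0 E j.
Proof. exact: nth_enc_ens. Qed.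

Definition int_input E (S : {set 'I_d}) (c j : nat) : nat := init_im E S (8 * j + (8 + c)).

Definition init_store E (x : 'I_d -> R) : store R :=
  Store (fun=> 0%N) (fun=> 0) (fun c j => if (c < 7)%N then init_rm E x (8 * j + c) else 0).

Lemma init_imE E S c j : (c < 8)%N -> init_im E S (8 * j + (8 + c)) =
  if c == 0%N then (if (j < ens_size E)%N then nat_of_bool (en_leaf (enc_node E j)) else 0%N)
  else if c == 1%N then en_feat (enc_node E j)
  else if c == 2%N then en_left (enc_node E j)
  else if c == 3%N then en_right (enc_node E j)
  else if c == 4%N then nth 0%N (enc_ens 0 E).2 j
  else if c == 5%N then (if insub j is Some i then nat_of_bool (i \in S) else 0%N)
  else 0%N.
Proof.
move=> Hc; rewrite /init_im ifF; last by lia.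
have -> : ((8 * j + (8 + c) - 8) %/ 8 = j)%N by lia.
have -> : ((8 * j + (8 + c) - 8) %% 8 = c)%N by lia.
by rewrite size_enc_ens.
Qed.

Lemma init_rmE E x c j : (c < 8)%N -> init_rm E x (8 * j + c) =
  if c == 0%N then en_val (enc_node E j)
  else if c == 1%N then (if insub j is Some i then x i else 0) else 0.
Proof.
move=> Hc; rewrite /init_rm.
have -> : ((8 * j + c) %/ 8 = j)%N by lia.
by have -> : ((8 * j + c) %% 8 = c)%N by lia.
Qed.

Lemma represents_init E x S :
  represents (ens_size E) (int_input E S) (init_store E x) (init_im E S) (init_rm E x).
Proof.
split=> //.
(* Register 0 lies in the header of the integer memory, register [k.+1] in the last column of block
   [k]. *)
- move=> [|k] //; rewrite /reg (_ : 8 * k.+1 + 7 = 8 * k + (8 + 7))%N; last by lia.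
  by rewrite init_imE.
- by move=> k; rewrite /reg init_rmE.
- by move=> k c Hc; rewrite /= Hc.
Qed.

End Encoding.

(** * The compiled program on the encoded ensemble *)

Theorem theorem3p1 (R : realType) :
  exists (prog : seq instr) (c : nat),
  forall (d : nat) (E : seq (tree d R)) (x : 'I_d -> R) (S : {set 'I_d})
    (dm : measure_display) (Omega : measurableType dm)
    (P : probability Omega R) (delta : 'I_d -> {RV P >-> R}),
    mutually_independent P S (fun i => delta i : Omega -> R) ->
    exists k : nat,
      (k <= c * (ens_size E) ^ 2 + c)%N /\
      let s := exec prog (feature_oracle P (fun i => delta i : Omega -> R)) k
                    (init_state E x S) in
      halted prog s /\
      ((rm s 0%N)%:E = PG2 P E x S (fun i => delta i : Omega -> R))%E.
Proof.
(* One program serves all inputs, and 2000 is the constant of [cost_pg2_cmd]. *)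
exists (compile 0 pg2_cmd), 2000%N => d E x S dm Omega P delta indep.
set oracle := feature_oracle _ _; set n := ens_size E.
have code : code_at (compile 0 pg2_cmd) 0 (compile 0 pg2_cmd) by [].
have [k [Im [M [Hk Hexec [_ _ _ _ Harr]]]]] :=
  @compile_correct R oracle n (int_input E S) _ 0 pg2_cmd wf_pg2_cmd code _ _ _
    (represents_init E x S).
exists k; split; first exact: leq_trans Hk (cost_pg2_cmd _).
rewrite /init_state Hexec; split.
  (* The final address is just behind the code, where the default instruction is [Halt]. *)
  by rewrite /halted nth_default // size_compile.
rewrite -[rm _ 0%N]/(M (8 * 0 + 0)%N) (Harr 0%N 0%N isT).
pose Y i w := perturbed x S (fun i => delta i : Omega -> R) w i.
pose conds' j := [seq it.2 | it <- ens_path 0 E j].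
pose leaf j := en_leaf (enc_node E j).
have evalE z : ens_eval E z =
    \sum_(0 <= j < n | leaf j) en_val (enc_node E j) * (sat z (conds' j))%:R.
  rewrite -(ens_evalE 0) add0n [LHS]big_mkcond [RHS]big_mkcond.
  by apply: eq_big_nat => j Hj; rewrite /leaf enc_nodeE.
(* The encoding instantiates the abstract tree data of the two passes; the remaining goals are their
   hypotheses. *)
rewrite (@den_pg2_cmd R d oracle n (int_input E S) x (gcdf P Y) leaf
  (fun j => en_feat (enc_node E j)) (fun j => en_left (enc_node E j))
  (fun j => en_right (enc_node E j)) (fun j => en_val (enc_node E j)) (ens_path 0 E)) //.
- rewrite /pair_sum /value_sum -/conds' -(mean_square_gap (measurable_perturbed _ _ _) (indep_perturbed x indep)).
  by rewrite /PG2; apply: eq_integral => w _; rewrite !evalE.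
- by move=> j jn; rewrite /int_input init_imE //= jn.
- by move=> j jn; rewrite /int_input init_imE.
- by move=> j jn; rewrite /int_input init_imE.
- by move=> j jn; rewrite /int_input init_imE.
- move=> q t; rewrite (perturbed_gcdf x S delta) /int_input init_imE //= valK lt0b.
  by rewrite /oracle /feature_oracle valK.
- move=> j jn; rewrite /leaf /node_at !enc_nodeE // => lj.
  have [//|q [t [H1 H2 H3 H4 H5]]] := ens_children (base := 0) (j := j) _ lj.
  by exists q, t; case: H1 => ? ?; split.
- move=> j jn; have [//|->|[w [c [H1 H2 H3 H4]]]] := @ens_parent R d 0 E j; [by left|right].
  have wn : (w < n)%N by apply: ltn_trans jn; case/andP: H2.
  by exists w, c; rewrite /leaf !enc_nodeE //; case/andP: H2.
- by move=> j; rewrite /= init_rmE.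
- by move=> q; rewrite /= init_rmE //= valK.
- by move=> [|[|c]] j //= _; case: ifP => // Hc; rewrite init_rmE //; lia.
Qed.
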